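(* Let $\Phi_1\in\mathcal C(A_0,A_1)$, $\Phi_2\in\mathcal C(A'_0,A_1)$ and $\epsilon\ge0$, and let $\delta_{\rm pre}(\Phi_1\|\Phi_2)=\min_{\Lambda\in\mathcal C(A'_0,A_0)}\|\Phi_1\circ\Lambda-\Phi_2\|_\diamond$. The following are equivalent. (i) $\delta_{\rm pre}(\Phi_1\|\Phi_2)\le\epsilon$. (ii) For every finite-dimensional ancilla $R_0$ and every $\rho\in\mathfrak S(R_0A_1)$, $$\|(\mathrm{id}_{R_0}\otimes\Phi_2^{\mathsf T})(\rho)\|^\diamond_{A'_0|R_0}\le\|(\mathrm{id}_{R_0}\otimes\Phi_1^{\mathsf T})(\rho)\|^\diamond_{A_0|R_0}+\frac{\epsilon}{2}\|\rho\|^\diamond_{A_1|R_0}.$$ (iii) For every ancilla $R_0$, every ensemble $\mathcal E=\{\lambda_i,\rho_i\}_{i=1}^k$ on $R_0A_1$ and every measurement $M=(M_1,\dots,M_k)$ on $A_1A_1$, $$\sup_{\alpha\in\mathcal C(R_0,A'_0)}P_{\rm succ}\big(((\Phi_2\circ\alpha)\otimes\mathrm{id}_{A_1})(\mathcal E),M\big)\le\sup_{\alpha\in\mathcal C(R_0,A_0)}P_{\rm succ}\big(((\Phi_1\circ\alpha)\otimes\mathrm{id}_{A_1})(\mathcal E),M\big)+\frac{\epsilon}{2}P_{\rm succ}(\mathcal E).$$ Moreover, (i) is also equivalent to (ii), resp. (iii), required only for $R_0=A'_0$.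
   Context: Finite-dimensional systems; $\mathcal C(X,Y)$ channels; $\|\cdot\|_\diamond$ diamond norm. For $\phi:\mathcal B(X)\to\mathcal B(Y)$ hermitian linear, $\phi^*$ is its Hilbert–Schmidt adjoint and $\phi^{\mathsf T}(Z)=(\phi^*(Z^{\mathsf T}))^{\mathsf T}$ (transpose in fixed standard bases), so $\Phi^{\mathsf T}$ maps $\mathcal B(A_1)$ to the input space of $\Phi$. For $X\in\mathcal B_h(R_0B)$ and $\phi\in\mathcal L(R_0,B)$ set $\langle X,\phi\rangle={\rm Tr}[XC_{\phi^*}]$, where $C_{\psi}=(\psi\otimes\mathrm{id})(|I\rangle\rangle\langle\langle I|)$ is the Choi matrix, $|I\rangle\rangle=\sum_i|i\rangle|i\rangle$. For $\rho\in\mathcal B_+(R_0B)$, $\|\rho\|^\diamond_{B|R_0}=\max_{\alpha\in\mathcal C(R_0,B)}\langle\rho,\alpha\rangle=\min\{\lambda>0:\rho\le\lambda\sigma\otimes I_B,\ \sigma\in\mathfrak S(R_0)\}$. An ensemble $\mathcal E=\{\lambda_i,\rho_i\}_{i=1}^k$ on $X$: states $\rho_i$ with probabilities $\lambda_i$; for a map $\Psi$, $\Psi(\mathcal E)=\{\lambda_i,\Psi(\rho_i)\}$; a $k$-outcome measurement $M$: $M_i\ge0$, $\sum M_i=I$; $P_{\rm succ}(\mathcal E,M)=\sum_i\lambda_i{\rm Tr}[\rho_iM_i]$, $P_{\rm succ}(\mathcal E)=\max_MP_{\rm succ}(\mathcal E,M)$. In (iii), $\Phi\circ\alpha$ acts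 on the $R_0$ part and the output is measured together with the $A_1$ part of the ensemble. *)

(* Defs.v *)
From HB Require Import structures.
From mathcomp Require Import all_boot all_order all_algebra.
From mathcomp Require Import complex mxtens.
From mathcomp Require Import boolp classical_sets reals.
Set Implicit Arguments. Unset Strict Implicit. Unset Printing Implicit Defensive.
Import Order.TTheory GRing.Theory Num.Theory.
Local Open Scope ring_scope.
Local Open Scope classical_set_scope.

Section QuantumDefs.
Context {R : realType}.
Local Notation C := (R[i]).

Definition adjmx m n (A : 'M[C]_(m, n)) : 'M[C]_(n, m) :=
  (map_mx (@conjc R) A)^T.

Definition psd n (A : 'M[C]_n) : Prop :=
  adjmx A = A /\ forall v : 'cV[C]_n, 0 <= (adjmx v *m A *m v) 0 0.
Definition density n (A : 'M[C]_n) : Prop := psd A /\ \tr A = 1.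
Definition unitary n (U : 'M[C]_n) : Prop := U *m adjmx U = 1%:M.

(* Trace norm, variational form: ||X||_1 = max_{U unitary} Re Tr[U X]. *)
Definition tnorm n (X : 'M[C]_n) : R :=
  sup [set @complex.Re R (\tr (U *m X)) | U in [set U : 'M[C]_n | unitary U]].

(* Systems are composed with the Kronecker ordering of mxtens:
   index of (i, j) in 'I_(m * n) is i * n + j (first factor major).
   idtens r phi  = id_{R} (x) phi  acting on 'M_(r * m);
   tensid k phi  = phi (x) id_{K}  acting on 'M_(m * k). *)
Definition idtens r m n (phi : 'M[C]_m -> 'M[C]_n) (X : 'M[C]_(r * m))
  : 'M[C]_(r * n) :=
  \matrix_(k, l)
    phi (\matrix_(p, q) X (mxtens_index ((mxtens_unindex k).1, p))
                          (mxtens_index ((mxtens_unindex l).1, q)))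
        (mxtens_unindex k).2 (mxtens_unindex l).2.
Arguments idtens r {m n} phi X.

Definition tensid k m n (phi : 'M[C]_m -> 'M[C]_n) (X : 'M[C]_(m * k))
  : 'M[C]_(n * k) :=
  \matrix_(a, b)
    phi (\matrix_(p, q) X (mxtens_index (p, (mxtens_unindex a).2))
                          (mxtens_index (q, (mxtens_unindex b).2)))
        (mxtens_unindex a).1 (mxtens_unindex b).1.
Arguments tensid k {m n} phi X.

Definition linmap m n (phi : 'M[C]_m -> 'M[C]_n) : Prop :=
  forall (a : C) (X Y : 'M[C]_m), phi (a *: X + Y) = a *: phi X + phi Y.
Definition posmap m n (phi : 'M[C]_m -> 'M[C]_n) : Prop :=
  forall X, psd X -> psd (phi X).
Definition cpmap m n (phi : 'M[C]_m -> 'M[C]_n) : Prop :=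
  forall r : nat, posmap (idtens r phi).
Definition tpmap m n (phi : 'M[C]_m -> 'M[C]_n) : Prop :=
  forall X, \tr (phi X) = \tr X.
Definition channel m n (phi : 'M[C]_m -> 'M[C]_n) : Prop :=
  [/\ linmap phi, cpmap phi & tpmap phi].

Definition diamond m n (phi : 'M[C]_m -> 'M[C]_n) : R :=
  sup [set tnorm (idtens m phi X)
      | X in [set X : 'M[C]_(m * m) | tnorm X <= 1]].

Definition delta_pre a0 a0' a1 (Phi1 : 'M[C]_a0 -> 'M[C]_a1)
  (Phi2 : 'M[C]_a0' -> 'M[C]_a1) : R :=
  inf [set diamond (fun X => Phi1 (L X) - Phi2 X)
      | L in [set L : 'M[C]_a0' -> 'M[C]_a0 | channel L]].

(* Hilbert-Schmidt adjoint phi^* : Tr[Y^dag phi(X)] = Tr[phi^*(Y)^dag X],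
   written entrywise: phi^*(Y)_{ij} = Tr[phi(E_ij)^dag Y]. *)
Definition hsadj m n (phi : 'M[C]_m -> 'M[C]_n) (Y : 'M[C]_n) : 'M[C]_m :=
  \matrix_(i, j) \tr (adjmx (phi (delta_mx i j)) *m Y).

Definition mtrans m n (phi : 'M[C]_m -> 'M[C]_n) (Z : 'M[C]_n) : 'M[C]_m :=
  (hsadj phi Z^T)^T.

(* |I>><<I| on X (x) X, and the Choi matrix C_psi = (psi (x) id)(|I>><<I|). *)
Definition maxent m : 'M[C]_(m * m) :=
  \matrix_(k, l) (((mxtens_unindex k).1 == (mxtens_unindex k).2)
                  && ((mxtens_unindex l).1 == (mxtens_unindex l).2))%:R.
Definition choi m n (psi : 'M[C]_m -> 'M[C]_n) : 'M[C]_(n * m) :=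
  tensid m psi (maxent m).

Definition pairing r b (X : 'M[C]_(r * b)) (phi : 'M[C]_r -> 'M[C]_b) : C :=
  \tr (X *m choi (hsadj phi)).

Definition cbnorm r b (rho : 'M[C]_(r * b)) : R :=
  sup [set @complex.Re R (pairing rho a)
      | a in [set a : 'M[C]_r -> 'M[C]_b | channel a]].

Definition ensemble k n (lam : 'I_k -> R) (rho : 'I_k -> 'M[C]_n) : Prop :=
  [/\ forall i, 0 <= lam i, \sum_(i < k) lam i = 1 & forall i, density (rho i)].
Definition measurement k n (M : 'I_k -> 'M[C]_n) : Prop :=
  (forall i, psd (M i)) /\ \sum_(i < k) M i = 1%:M.
Definition psucc k n (lam : 'I_k -> R) (rho : 'I_k -> 'M[C]_n)
  (M : 'I_k -> 'M[C]_n) : R :=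
  \sum_(i < k) lam i * @complex.Re R (\tr (rho i *m M i)).
Definition psucc_opt k n (lam : 'I_k -> R) (rho : 'I_k -> 'M[C]_n) : R :=
  sup [set psucc lam rho M | M in [set M : 'I_k -> 'M[C]_n | measurement M]].

Definition cond_ii a0 a0' a1 (Phi1 : 'M[C]_a0 -> 'M[C]_a1)
  (Phi2 : 'M[C]_a0' -> 'M[C]_a1) (eps : R) (r : nat) : Prop :=
  forall rho : 'M[C]_(r * a1), density rho ->
    cbnorm (idtens r (mtrans Phi2) rho)
    <= cbnorm (idtens r (mtrans Phi1) rho) + eps / 2 * cbnorm rho.

Definition cond_iii a0 a0' a1 (Phi1 : 'M[C]_a0 -> 'M[C]_a1)
  (Phi2 : 'M[C]_a0' -> 'M[C]_a1) (eps : R) (r : nat) : Prop :=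
  forall (k : nat) (lam : 'I_k -> R) (rho : 'I_k -> 'M[C]_(r * a1))
         (M : 'I_k -> 'M[C]_(a1 * a1)),
    ensemble lam rho -> measurement M ->
    sup [set psucc lam (fun i => tensid a1 (Phi2 \o al) (rho i)) M
        | al in [set al : 'M[C]_r -> 'M[C]_a0' | channel al]]
    <= sup [set psucc lam (fun i => tensid a1 (Phi1 \o al) (rho i)) M
           | al in [set al : 'M[C]_r -> 'M[C]_a0 | channel al]]
       + eps / 2 * psucc_opt lam rho.

End QuantumDefs.

(* Main.v *)
(** Write [<W, g>] for [pairing W g].  For a difference [psi] of two channels, half
    its diamond norm is the supremum of [<W, psi>] over the tests
    [0 <= W <= s (x) 1] with [s] a state: the Choi matrix of [psi] has vanishing
    marginal, so the test operator coming from an arbitrary unitary can be shifted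
    by [s (x) 1] to become positive.  Hence (i) says that a channel [b] beats all
    tests simultaneously, and by a minimax theorem this amounts to beating each
    test separately.  A test [W] satisfies [cbnorm W <= 1], so this follows from
    (ii); it follows from (iii) by discriminating the orbit of [W] under signed
    cyclic shifts of the second factor, for which no measurement does better
    than the bound [s (x) 1] allows.
    Conversely, (i) gives (ii) because a second use of minimax produces, for every
    positive [rho], a state [s] with [rho <= cbnorm rho * (s (x) 1)] up to an
    arbitrarily small error; and (iii) is (ii) for the operator obtained by
    contracting the ensemble with the measurement. *)
Require Import Defs.
From HB Require Import structures.
From mathcomp Require Import all_boot all_order all_algebra.
From mathcomp Require Import complex mxtens spectral sesquilinear.
From mathcomp Require Import boolp classical_sets reals.
From mathcomp Require Import ring lra.
Set Implicit Arguments. Unset Strict Implicit. Unset Printing Implicit Defensive.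
Import Order.TTheory GRing.Theory Num.Theory.
Local Open Scope ring_scope.

(** * Adjoints, traces and the Hilbert-Schmidt norm *)
Section Adjoint.
Context {R : realType}.
Local Notation C := (R[i]).
Implicit Types (m n p : nat).

(** The optima in the definitions are suprema and infima whose attainment is never established. Each
    is replaced by a nearly optimal element, each comparison carries an error sent to zero at the
    end, and a set must be shown nonempty and bounded before its [sup] says anything.

    The ancilla is handled by moving channels onto operators. A channel from [R0] to [A'0] can be
    absorbed into the operator it is paired with, leaving an operator on [A'0 A1]; so (i) controls
    all ancillas at once. Conversely, for [R0 = A'0] the identity channel is an admissible strategy,
    and the condition then speaks about every test directly.

    The factor [eps / 2] arises because a hermitian contraction has the form [2 P - 1] with [P]
    between 0 and 1, and only [2 P] contributes against a difference of channels. For the same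
    reason [W] and its complement [s (x) 1 - W] pair with such a difference to opposite values, so
    inequalities in one direction over all tests control the two-sided norm. *)

Lemma conjcM (x y : C) : conjc (x * y) = conjc x * conjc y.
Proof. exact: rmorphM. Qed.

Lemma conjcD (x y : C) : conjc (x + y) = conjc x + conjc y.
Proof. exact: rmorphD. Qed.

Lemma conjcN (x : C) : conjc (- x) = - conjc x.
Proof. exact: rmorphN. Qed.

Lemma conjc_sum I (r : seq I) (P : pred I) (F : I -> C) :
  conjc (\sum_(i <- r | P i) F i) = \sum_(i <- r | P i) conjc (F i).
Proof. exact: rmorph_sum. Qed.

Lemma adjmxE m n (A : 'M[C]_(m, n)) i j : adjmx A i j = conjc (A j i).
Proof. by rewrite !mxE. Qed.

Lemma adjmxK m n (A : 'M[C]_(m, n)) : adjmx (adjmx A) = A.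
Proof. by apply/matrixP=> i j; rewrite !adjmxE conjcK. Qed.

Lemma adjmxM m n p (A : 'M[C]_(m, n)) (B : 'M[C]_(n, p)) :
  adjmx (A *m B) = adjmx B *m adjmx A.
Proof. by rewrite /adjmx map_mxM trmx_mul. Qed.

Lemma adjmxD m n (A B : 'M[C]_(m, n)) : adjmx (A + B) = adjmx A + adjmx B.
Proof. by rewrite /adjmx map_mxD linearD. Qed.

Lemma adjmxN m n (A : 'M[C]_(m, n)) : adjmx (- A) = - adjmx A.
Proof. by rewrite /adjmx map_mxN linearN. Qed.

Lemma adjmxZ m n (a : R) (A : 'M[C]_(m, n)) :
  adjmx (a%:C%C *: A) = a%:C%C *: adjmx A.
Proof. by rewrite /adjmx map_mxZ linearZ /= oppr0. Qed.

Lemma adjmx0 m n : adjmx (0 : 'M[C]_(m, n)) = 0.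
Proof. by rewrite /adjmx map_mx0 trmx0. Qed.

Lemma adjmx1 n : adjmx (1%:M : 'M[C]_n) = 1%:M.
Proof. by rewrite /adjmx map_mx1 trmx1. Qed.

Lemma adjmx_sum m n I (r : seq I) (P : pred I) (F : I -> 'M[C]_(m, n)) :
  adjmx (\sum_(i <- r | P i) F i) = \sum_(i <- r | P i) adjmx (F i).
Proof. exact: (big_morph _ (@adjmxD m n) (@adjmx0 m n)). Qed.

Lemma adjmx_tr m n (A : 'M[C]_(m, n)) : adjmx A^T = (adjmx A)^T.
Proof. by apply/matrixP=> i j; rewrite !mxE. Qed.

Lemma adjmx_tens m n p q (A : 'M[C]_(m, n)) (B : 'M[C]_(p, q)) :
  adjmx (A *t B) = adjmx A *t adjmx B.
Proof. by rewrite /adjmx map_mxT trmx_tens. Qed.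

Definition rtr n (A : 'M[C]_n) : R := complex.Re (\tr A).

Lemma ReD (x y : C) : complex.Re (x + y) = complex.Re x + complex.Re y.
Proof. by case: x; case: y. Qed.

Lemma ReN (x : C) : complex.Re (- x) = - complex.Re x.
Proof. by case: x. Qed.

Lemma ReZ (a : R) (x : C) : complex.Re (a%:C%C * x) = a * complex.Re x.
Proof. by case: x => x y /=; rewrite mul0r subr0. Qed.

Lemma Re_conjc (x : C) : complex.Re (conjc x) = complex.Re x.
Proof. by case: x. Qed.

Lemma Re_sum I (r : seq I) (P : pred I) (F : I -> C) :
  complex.Re (\sum_(i <- r | P i) F i) = \sum_(i <- r | P i) complex.Re (F i).
Proof. exact: (big_morph _ ReD). Qed.

Lemma ge0_Re (x : C) : 0 <= x -> 0 <= complex.Re x.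
Proof. by rewrite lecE => /andP[]. Qed.

Lemma ge0_complexE (x : C) : 0 <= x -> x = (complex.Re x)%:C%C.
Proof. by case: x => a b; rewrite lecE /= => /andP[/eqP -> _]. Qed.

Lemma rtrD n (A B : 'M[C]_n) : rtr (A + B) = rtr A + rtr B.
Proof. by rewrite /rtr mxtraceD ReD. Qed.

Lemma rtrN n (A : 'M[C]_n) : rtr (- A) = - rtr A.
Proof. by rewrite /rtr linearN /= ReN. Qed.

Lemma rtrB n (A B : 'M[C]_n) : rtr (A - B) = rtr A - rtr B.
Proof. by rewrite rtrD rtrN. Qed.

Lemma rtrZ n (a : R) (A : 'M[C]_n) : rtr (a%:C%C *: A) = a * rtr A.
Proof. by rewrite /rtr mxtraceZ ReZ. Qed.

Lemma rtr0 n : rtr (0 : 'M[C]_n) = 0.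
Proof. by rewrite /rtr mxtrace0. Qed.

Lemma rtr1 n : rtr (1%:M : 'M[C]_n) = n%:R.
Proof.
by rewrite /rtr mxtrace1 -(rmorph_nat (real_complex R)).
Qed.

Lemma rtr_sum n I (r : seq I) (P : pred I) (F : I -> 'M[C]_n) :
  rtr (\sum_(i <- r | P i) F i) = \sum_(i <- r | P i) rtr (F i).
Proof. exact: (big_morph _ (@rtrD n) (@rtr0 n)). Qed.

Lemma rtrC m n (A : 'M[C]_(m, n)) (B : 'M[C]_(n, m)) :
  rtr (A *m B) = rtr (B *m A).
Proof. by rewrite /rtr mxtrace_mulC. Qed.

Lemma rtr_adj n (A : 'M[C]_n) : rtr (adjmx A) = rtr A.
Proof.
rewrite /rtr /adjmx mxtrace_tr /mxtrace !Re_sum; apply: eq_bigr => i _.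
by rewrite mxE Re_conjc.
Qed.

Definition nsq m n (A : 'M[C]_(m, n)) : R := rtr (A *m adjmx A).

Lemma nsqE m n (A : 'M[C]_(m, n)) :
  nsq A = \sum_i \sum_j (complex.Re (A i j) ^+ 2 + complex.Im (A i j) ^+ 2).
Proof.
rewrite /nsq /rtr /mxtrace Re_sum; apply: eq_bigr => i _.
rewrite mxE Re_sum; apply: eq_bigr => j _; rewrite adjmxE.
by case: (A i j) => a b /=; rewrite mulrN opprK !expr2.
Qed.

Lemma nsq_ge0 m n (A : 'M[C]_(m, n)) : 0 <= nsq A.
Proof.
by rewrite nsqE; do 2![apply: sumr_ge0 => ? _]; rewrite addr_ge0 ?sqr_ge0.
Qed.

Lemma nsq_eq0 m n (A : 'M[C]_(m, n)) : nsq A <= 0 -> A = 0.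
Proof.
move=> A0; have : nsq A == 0 by rewrite eq_le A0 nsq_ge0.
rewrite nsqE psumr_eq0 => [/allP h|i _]; last first.
  by apply: sumr_ge0 => ? _; rewrite addr_ge0 ?sqr_ge0.
apply/matrixP=> i j; rewrite mxE; have /= := h i (mem_index_enum _).
rewrite psumr_eq0 => [/allP /(_ j (mem_index_enum _)) /=|k _]; last first.
  by rewrite addr_ge0 ?sqr_ge0.
rewrite paddr_eq0 ?sqr_ge0 // !sqrf_eq0 => /andP[/eqP a0 /eqP b0].
by case: (A i j) a0 b0 => a b /= -> ->.
Qed.

Lemma nsqZ m n (a : R) (A : 'M[C]_(m, n)) : nsq (a%:C%C *: A) = a ^+ 2 * nsq A.
Proof. by rewrite /nsq adjmxZ -scalemxAl -scalemxAr !rtrZ mulrA expr2. Qed.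

Lemma nsq_adj m n (A : 'M[C]_(m, n)) : nsq (adjmx A) = nsq A.
Proof. by rewrite /nsq adjmxK rtrC. Qed.

Lemma nsqB m n (A B : 'M[C]_(m, n)) :
  nsq (A - B) = nsq A + nsq B - 2 * rtr (A *m adjmx B).
Proof.
rewrite /nsq adjmxD adjmxN mulmxBl !mulmxBr !rtrB.
have -> : rtr (B *m adjmx A) = rtr (A *m adjmx B).
  by rewrite -[LHS]rtr_adj adjmxM adjmxK.
by ring.
Qed.

Lemma nsqD m n (A B : 'M[C]_(m, n)) :
  nsq (A + B) = nsq A + nsq B + 2 * rtr (A *m adjmx B).
Proof.
have := nsqB A (- B); rewrite opprK adjmxN mulmxN rtrN => ->.
rewrite -[- B]scaleN1r -(rmorphN1 (real_complex R)) nsqZ; ring.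
Qed.

(** Expand the square norm of [a A - adjmx B] and divide by [a]. This stands in for Cauchy-Schwarz;
    the free weight [a] is tuned in [minimax] when one near-maximiser replaces another. *)
Lemma rtr_le_nsq m n (A : 'M[C]_(m, n)) (B : 'M[C]_(n, m)) (a : R) : 0 < a ->
  2 * rtr (A *m B) <= a * nsq A + a^-1 * nsq B.
Proof.
move=> a0; have := nsq_ge0 (a%:C%C *: A - adjmx B).
rewrite nsqB adjmxK -scalemxAl rtrZ nsqZ nsq_adj => h.
have : 0 <= a^-1 * (a ^+ 2 * nsq A + nsq B - 2 * (a * rtr (A *m B))).
  by rewrite mulr_ge0 // invr_ge0 ltW.
have -> : a^-1 * (a ^+ 2 * nsq A + nsq B - 2 * (a * rtr (A *m B))) =
  a * nsq A + a^-1 * nsq B - 2 * rtr (A *m B) by field; rewrite gt_eqF.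
lra.
Qed.

End Adjoint.

(** * Positive semidefinite matrices *)
Section Psd.
Context {R : realType}.
Local Notation C := (R[i]).
Implicit Types (m n p : nat).

Definition qf n (A : 'M[C]_n) (u v : 'cV[C]_n) : C := (adjmx u *m A *m v) 0 0.

Lemma qfE n (A : 'M[C]_n) u v :
  qf A u v = \sum_i \sum_j conjc (u i 0) * A i j * v j 0.
Proof.
rewrite /qf mxE exchange_big; apply: eq_bigr => j _ /=.
by rewrite mxE mulr_suml; apply: eq_bigr => i _; rewrite adjmxE.
Qed.

Lemma conjc_qf n (A : 'M[C]_n) u v : conjc (qf A u v) = qf (adjmx A) v u.
Proof.
rewrite /qf -adjmxE; congr (_ 0 0).
by rewrite !adjmxM adjmxK mulmxA.
Qed.

Lemma adjmx_delta m n i j : adjmx (delta_mx i j : 'M[C]_(m, n)) = delta_mx j i.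
Proof.
apply/matrixP=> a b; rewrite adjmxE !mxE andbC.
by case: (_ && _); rewrite ?conjc1 ?conjc0.
Qed.

Lemma qf_delta n (B : 'M[C]_n) i j : qf B (delta_mx i 0) (delta_mx j 0) = B i j.
Proof. by rewrite /qf adjmx_delta -rowE -colE !mxE. Qed.

(** Over the complex numbers a nonnegative quadratic form is automatically hermitian: its reality at
    [u + v] and at [u + i v] fixes the symmetric and the skew part of [qf A u v]. *)
Lemma psd_qf n (A : 'M[C]_n) : (forall v, 0 <= qf A v v) -> psd A.
Proof.
move=> pA; split; last exact: pA.
have rA u : conjc (qf A u u) = qf A u u.
  by rewrite (ge0_complexE (pA u)) conjc_real.
have lin (x y x' y' : C) : x' = y' -> x - y = x' - y' -> x = y.
  by move=> -> /eqP; rewrite subrr subr_eq0 => /eqP.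
have sym u v : qf A u v + qf A v u = conjc (qf A u v) + conjc (qf A v u).
  have := rA (u + v); rewrite /qf adjmxD !(mulmxDl, mulmxDr) => /eqP.
  rewrite ![(_ + _ : 'M__) 0 0]mxE -!/(qf _ _ _) !conjcD !rA.
  by move=> /eqP h; apply: (lin _ _ _ _ (esym h)); ring.
have skew u v : qf A u v - qf A v u = - (conjc (qf A u v) - conjc (qf A v u)).
  have ci : conjc 'i%C = - 'i%C :> C by apply/eqP; rewrite eq_complex /= oppr0 !eqxx.
  have iZ w x : qf A ('i%C *: w) x = - 'i%C * qf A w x.
    rewrite /qf; have -> : adjmx ('i%C *: w) = - 'i%C *: adjmx w.
      by apply/matrixP=> i j; rewrite !mxE conjcM ci.
    by rewrite -!scalemxAl mxE.
  have Zi w x : qf A w ('i%C *: x) = 'i%C * qf A w x.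
    by rewrite /qf -!scalemxAr mxE.
  have := sym u ('i%C *: v); rewrite iZ Zi !conjcM conjcN ci.
  move=> h; apply: (mulfI (_ : 'i%C != 0)); first by rewrite eq_complex /= oner_eq0 andbF.
  by apply: (lin _ _ _ _ h); ring.
have herm u v : conjc (qf A v u) = qf A u v.
  have h1 := sym u v; have h2 := skew u v.
  apply: (mulfI (_ : 2%:R != 0)); first by rewrite pnatr_eq0.
  apply: (lin _ _ _ _ (esym (congr2 +%R h1 h2))) => /=; ring.
apply/matrixP=> i j; rewrite -!qf_delta -conjc_qf.
exact: herm.
Qed.

Lemma psd0 n : psd (0 : 'M[C]_n).
Proof. by apply: psd_qf => v; rewrite /qf mulmx0 mul0mx mxE. Qed.

Lemma psdD n (A B : 'M[C]_n) : psd A -> psd B -> psd (A + B).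
Proof.
move=> [_ pA] [_ pB]; apply: psd_qf => v.
by rewrite /qf mulmxDr mulmxDl mxE addr_ge0.
Qed.

Lemma psdZ n (a : R) (A : 'M[C]_n) : 0 <= a -> psd A -> psd (a%:C%C *: A).
Proof.
move=> a0 [_ pA]; apply: psd_qf => v.
by rewrite /qf -scalemxAr -scalemxAl mxE mulr_ge0 ?ler0c.
Qed.

Lemma psd_sum n I (r : seq I) (P : pred I) (F : I -> 'M[C]_n) :
  (forall i, P i -> psd (F i)) -> psd (\sum_(i <- r | P i) F i).
Proof. by move=> h; apply: big_ind => //; [exact: psd0|exact: psdD]. Qed.

Lemma psd_conj m n (B : 'M[C]_(m, n)) (A : 'M[C]_n) :
  psd A -> psd (B *m A *m adjmx B).
Proof.
move=> [_ pA]; apply: psd_qf => v; have := pA (adjmx B *m v).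
by rewrite /qf adjmxM adjmxK !mulmxA.
Qed.

Lemma psd1 n : psd (1%:M : 'M[C]_n).
Proof.
apply: psd_qf => v; rewrite qfE; apply: sumr_ge0 => i _.
rewrite (bigD1 i) //= mxE eqxx mulr1 big1 ?addr0 => [|j /negPf ij].
  by rewrite mulrC mulcJ_ge0.
by rewrite mxE eq_sym ij mulr0 mul0r.
Qed.

Lemma psd_mulmx_adj m n (B : 'M[C]_(m, n)) : psd (B *m adjmx B).
Proof. by have := psd_conj B (psd1 n); rewrite mulmx1. Qed.

Lemma psd_adj_mulmx m n (B : 'M[C]_(m, n)) : psd (adjmx B *m B).
Proof. by have := psd_mulmx_adj (adjmx B); rewrite adjmxK. Qed.

Lemma psd_tr n (A : 'M[C]_n) : psd A -> psd A^T.
Proof.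
move=> [_ pA]; apply: psd_qf => v; have := pA (adjmx v)^T.
congr (0 <= _); rewrite -/(qf _ _ _) !qfE exchange_big.
apply: eq_bigr => i _; apply: eq_bigr => j _; rewrite !mxE ?conjcK.
by rewrite [LHS]mulrC [LHS]mulrA [LHS]mulrAC.
Qed.

Definition dgmx n (d : 'rV[R]_n) : 'M[C]_n := diag_mx (map_mx (real_complex R) d).

Lemma dgmxM n (d e : 'rV[R]_n) :
  dgmx d *m dgmx e = dgmx (\row_j (d 0 j * e 0 j)).
Proof.
rewrite /dgmx mulmx_diag; congr diag_mx; apply/rowP=> j.
by rewrite !mxE rmorphM.
Qed.

Lemma adjmx_dgmx n (d : 'rV[R]_n) : adjmx (dgmx d) = dgmx d.
Proof.
apply/matrixP=> i j; rewrite !mxE eq_sym; case: eqP => [->|_].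
  by rewrite mulr1n conjc_real.
by rewrite mulr0n conjc0.
Qed.

Lemma rtr_dgmx n (d : 'rV[R]_n) : rtr (dgmx d) = \sum_j d 0 j.
Proof.
by rewrite /rtr mxtrace_diag Re_sum; apply: eq_bigr => j _; rewrite mxE.
Qed.

Lemma rtr_dgmxM n (d : 'rV[R]_n) (A : 'M[C]_n) :
  rtr (dgmx d *m A) = \sum_j d 0 j * complex.Re (A j j).
Proof.
rewrite /rtr /mxtrace Re_sum; apply: eq_bigr => j _.
by rewrite mul_diag_mx !mxE ReZ.
Qed.

Lemma dgmx1 n : dgmx (const_mx 1 : 'rV[R]_n) = 1%:M.
Proof. by rewrite /dgmx map_const_mx diag_const_mx rmorph1. Qed.

Lemma hermitian_spectral n (A : 'M[C]_n) : adjmx A = A ->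
  exists V d, unitary V /\ A = adjmx V *m dgmx d *m V.
Proof.
move=> hA.
have adjE k (B : 'M[C]_k) : adjmx B = (B ^t Num.conj)%sesqui.
  by apply/matrixP=> i j; rewrite !mxE.
have hermA : A \is hermsymmx.
  by apply/is_hermitianmxP; rewrite expr0 scale1r -adjE hA.
have uV := spectral_unitarymx A.
exists (spectralmx A); exists (map_mx (@complex.Re R) (spectral_diag A)).
split; first by rewrite /unitary adjE; apply/unitarymxP.
have /orthomx_spectralP := hermitian_normalmx hermA.
rewrite (invmx_unitary uV) -adjE => {1}->; congr (_ *m _ *m _).
rewrite /dgmx; congr diag_mx; apply/rowP=> j; rewrite !mxE.
have /mxOverP /(_ 0 j) := hermitian_spectral_diag_real hermA.
by move=> /RRe_real ->.
Qed.

Lemma unitary_diagE n (V A : 'M[C]_n) (d : 'rV[R]_n) : unitary V ->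
  A = adjmx V *m dgmx d *m V ->
  forall j, qf A (col j (adjmx V)) (col j (adjmx V)) = (d 0 j)%:C%C.
Proof.
move=> uV -> j.
have -> : col j (adjmx V) = adjmx V *m delta_mx j 0 by rewrite colE.
rewrite /qf adjmxM adjmxK !mulmxA.
rewrite -(mulmxA _ V) uV mulmx1 -(mulmxA _ V) uV mulmx1.
by rewrite adjmx_delta -rowE -colE !mxE eqxx mulr1n.
Qed.

Lemma psd_spectral n (A : 'M[C]_n) : psd A ->
  exists V d, [/\ unitary V, A = adjmx V *m dgmx d *m V & forall j, 0 <= d 0 j].
Proof.
move=> [hA pA]; have [V [d [uV Ad]]] := hermitian_spectral hA.
exists V, d; split=> // j; have := pA (col j (adjmx V)).
by rewrite -/(qf _ _ _) (unitary_diagE uV Ad) ler0c.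
Qed.

Lemma psd_factor n (A : 'M[C]_n) : psd A -> exists B : 'M[C]_n, A = B *m adjmx B.
Proof.
move=> /psd_spectral[V [d [uV -> d0]]].
exists (adjmx V *m dgmx (\row_j Num.sqrt (d 0 j))).
rewrite adjmxM adjmxK adjmx_dgmx mulmxA -[in RHS](mulmxA (adjmx V)) dgmxM.
congr (_ *m dgmx _ *m _); apply/rowP=> j.
by rewrite !mxE -expr2 sqr_sqrtr.
Qed.

Lemma psd_tr_ge0 n (A B : 'M[C]_n) : psd A -> psd B -> 0 <= \tr (A *m B).
Proof.
move=> /psd_factor[D ->] pB; rewrite -mulmxA mxtrace_mulC.
have [_ h] := psd_conj (adjmx D) pB; rewrite adjmxK in h.
rewrite /mxtrace; apply: sumr_ge0 => i _; have := h (delta_mx i 0).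
by rewrite -/(qf _ _ _) qf_delta ?mulmxA -?mulmxA.
Qed.

Lemma psd_rtr_ge0 n (A B : 'M[C]_n) : psd A -> psd B -> 0 <= rtr (A *m B).
Proof. by move=> pA pB; apply: ge0_Re; exact: psd_tr_ge0. Qed.

Lemma rtr_psd n (A : 'M[C]_n) : psd A -> 0 <= rtr A.
Proof. by move=> pA; have := psd_rtr_ge0 pA (psd1 n); rewrite mulmx1. Qed.

Lemma rtr_le n (A B D : 'M[C]_n) : psd D -> psd (B - A) ->
  rtr (A *m D) <= rtr (B *m D).
Proof. by move=> pD pBA; have := psd_rtr_ge0 pBA pD; rewrite mulmxBl rtrB subr_ge0. Qed.

Lemma psd_trE n (A : 'M[C]_n) : psd A -> \tr A = (rtr A)%:C%C.
Proof.
move=> pA; have := psd_tr_ge0 pA (psd1 n); rewrite mulmx1.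
exact: ge0_complexE.
Qed.

Lemma psd_dgmx n (d : 'rV[R]_n) : (forall j, 0 <= d 0 j) -> psd (dgmx d).
Proof.
move=> d0; have -> : dgmx d = dgmx (\row_j Num.sqrt (d 0 j))
    *m adjmx (dgmx (\row_j Num.sqrt (d 0 j))).
  rewrite adjmx_dgmx dgmxM; congr dgmx; apply/rowP=> j.
  by rewrite !mxE -expr2 sqr_sqrtr.
exact: psd_mulmx_adj.
Qed.

(** Nonnegative eigenvalues are each at most their sum. Crude, but enough for the a priori bounds
    that the suprema and [minimax] ask for. *)
Lemma psd_le_rtr n (A : 'M[C]_n) : psd A -> psd ((rtr A)%:C%C *: 1%:M - A).
Proof.
move=> /psd_spectral[V [d [uV -> d0]]].
have uV' : adjmx V *m V = 1%:M := mulmx1C uV.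
have -> : rtr (adjmx V *m dgmx d *m V) = \sum_j d 0 j.
  by rewrite rtrC mulmxA uV mul1mx rtr_dgmx.
set s := \sum_j _.
have -> : s%:C%C *: 1%:M - adjmx V *m dgmx d *m V =
   adjmx V *m dgmx (\row_j (s - d 0 j)) *m adjmx (adjmx V).
  rewrite adjmxK; have -> : dgmx (\row_j (s - d 0 j)) = s%:C%C *: 1%:M - dgmx d.
    apply/matrixP=> i j; rewrite !mxE; case: eqP => _; rewrite ?mulr1n ?mulr0n.
      by rewrite rmorphB mulr1.
    by rewrite mulr0 subr0.
  by rewrite mulmxBr mulmxBl -scalemxAr -scalemxAl mulmx1 uV'.
apply: psd_conj; apply: psd_dgmx => j; rewrite mxE subr_ge0 /s (bigD1 j) //=.
by rewrite lerDl sumr_ge0.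
Qed.

Lemma psd_nsq n (A : 'M[C]_n) : psd A -> nsq A <= rtr A ^+ 2.
Proof.
move=> pA; have := rtr_le pA (psd_le_rtr pA).
by rewrite -scalemxAl rtrZ mul1mx /nsq; case: pA => -> _; rewrite expr2.
Qed.

End Psd.

(** * An approximate minimax theorem *)
Section Minimax.
Context {R : realType}.
Local Notation C := (R[i]).
Local Open Scope classical_set_scope.

Lemma le_addgt0 (x y : R) : (forall e, 0 < e -> x <= y + e) -> x <= y.
Proof. by move=> h; apply/ler_addgt0Pr. Qed.

(** The parallelogram law; its last term is the strong convexity behind the regularised payoff of
    [minimax]. *)
Lemma nsq_midpoint m n (A B : 'M[C]_(m, n)) :
  nsq ((2^-1)%:C%C *: (A + B)) = 2^-1 * nsq A + 2^-1 * nsq B - 4^-1 * nsq (A - B).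
Proof. by rewrite nsqZ nsqD nsqB; field. Qed.

Lemma sup_image_ge (T : Type) (P : set T) (F : T -> R) (M : R) p :
  (forall p, P p -> F p <= M) -> P p -> F p <= sup [set F p | p in P].
Proof.
move=> hM Pp; apply: ub_le_sup; last by exists p.
by exists M => _ [q Pq <-]; exact: hM.
Qed.

Lemma sup_image_le (T : Type) (P : set T) (F : T -> R) (M : R) p0 : P p0 ->
  (forall p, P p -> F p <= M) -> sup [set F p | p in P] <= M.
Proof.
move=> Pp0 hM; apply: ge_sup; first by exists (F p0), p0.
by move=> _ [q Pq <-]; exact: hM.
Qed.

Lemma sup_image_adherent (T : Type) (P : set T) (F : T -> R) (M e : R) p0 :
  P p0 -> (forall p, P p -> F p <= M) -> 0 < e ->
  exists2 p, P p & sup [set F p | p in P] - e < F p.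
Proof.
move=> Pp0 hM e0; have [|_ [p Pp <-] h] := @sup_adherent _ [set F p | p in P] e e0.
  by split; [exists (F p0), p0 | exists M => _ [q Pq <-]; exact: hM].
by exists p.
Qed.

(** Arithmetic core of [minimax]. There [t] is the length of a step from a nearly optimal [s1]
    towards a rival [s], [pt] nearly maximises the game after the step, and [a], [b] are the payoffs
    of [pt] against [s] and [s1]. Near-optimality up to [t * t] gives [a - b >= - 2 t] after
    division by [t]. Since [pt] is still nearly maximal at [s1], strong concavity bounds the squared
    distance [N] of the two maximisers by a multiple of [t]. *)
Lemma minimax_estimate (e mu r t M D X N g0 G1 Gt Ft F1 Fp a b rt nl : R) :
  0 < e -> 0 < mu -> 0 < r -> 0 < t -> t <= 1 -> 0 <= M -> X <= e / 4 -> r * D <= e / 2 ->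
  t * ((4 + 2 * M) + 2 / (mu * r) * (2 + M)) <= e / 4 ->
  - X <= g0 -> G1 < g0 + t * t -> g0 <= Gt -> Gt - t * t < Ft ->
  G1 - t * t < F1 -> Ft = Fp + t * (a - b) -> Fp <= G1 -> Fp <= b ->
  2^-1 * F1 + 2^-1 * Fp + mu / 4 * N <= G1 ->
  a <= M -> - M <= b ->
  nl <= D -> 2 * rt <= r * nl + r^-1 * N ->
  - e <= a - rt.
Proof.
move=> e0 mu0 r0 t0 t1 M0 hX rD tK hg h1 h2 h3 h4 hF h5 h6 h7 aM bM nlD hrt.
have tt : t * t <= t by rewrite ler_piMr // ltW.
have tab : t * (a - b) <= t * (2 * M) by rewrite ler_pM2l //; lra.
have ab : - (2 * t) <= a - b.
  have h : t * (- (2 * t)) <= t * (a - b).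
    by rewrite mulrN mulrCA; lra.
  by rewrite ler_pM2l in h.
have hN : mu / 4 * N <= t * (2 + M) by lra.
have hb : - (e / 4) - t * (2 + 2 * M) <= b by lra.
have hr : r * nl <= r * D by rewrite ler_pM2l.
have hNr : N / (2 * r) <= t * (2 / (mu * r) * (2 + M)).
  have -> : N / (2 * r) = 2 / (mu * r) * (mu / 4 * N).
    by field; rewrite !gt_eqF.
  rewrite [t * _]mulrCA ler_pM2l // divr_gt0 // mulr_gt0 //.
have hN2 : N / (2 * r) = r^-1 * N / 2 by field; rewrite gt_eqF.
move: tK; rewrite mulrDr; lra.
Qed.

(* The inner supremum is regularised by [mu * nsq p], which makes near-maximisers
   of nearby games close to each other; hence no compactness is needed. *)
Lemma minimax n (P : set 'M[C]_n) (S : set ('M[C]_n * R)) (B D : R) p0 s0 :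
  P p0 -> S s0 ->
  (forall p q, P p -> P q -> P ((2^-1)%:C%C *: (p + q))) ->
  (forall p, P p -> nsq p <= B) ->
  (forall t s s', 0 <= t <= 1 -> S s -> S s' ->
    S ((1 - t)%:C%C *: s.1 + t%:C%C *: s'.1, (1 - t) * s.2 + t * s'.2)) ->
  (forall s, S s -> nsq s.1 <= D /\ `|s.2| <= D) ->
  (forall s e, S s -> 0 < e -> exists2 p, P p & - e <= rtr (s.1 *m p) + s.2) ->
  forall e, 0 < e ->
  exists2 p, P p & forall s, S s -> - e <= rtr (s.1 *m p) + s.2.
Proof.
move=> Pp0 Ss0 Pmid PB Sconv SD hS e e0.
pose f (s : 'M[C]_n * R) p := rtr (s.1 *m p) + s.2.
have B0 : 0 <= B := le_trans (nsq_ge0 _) (PB _ Pp0).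
have D0 : 0 <= D := le_trans (nsq_ge0 _) (SD _ Ss0).1.
pose M := (B + D) / 2 + D.
have M0 : 0 <= M by rewrite /M; lra.
have fM s p : S s -> P p -> - M <= f s p <= M.
  move=> Ss Pp; have := rtr_le_nsq s.1 p ltr01; have := rtr_le_nsq (- s.1) p ltr01.
  rewrite invr1 !mul1r mulNmx rtrN.
  have -> : nsq (- s.1) = nsq s.1.
    by rewrite -scaleN1r -(rmorphN1 (real_complex R)) nsqZ; ring.
  have [sD cD] := SD _ Ss; have := PB _ Pp.
  have := ler_norm s.2; have := ler_norm (- s.2); rewrite normrN /f /M; lra.
(* The regulariser lowers the value of a game by at most [e / 4]; the [+ 1] guards against division
   by zero. *)
pose mu := e / (4 * (B + 1)).
have mu0 : 0 < mu by rewrite /mu divr_gt0 //; lra.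
have muB : mu * B <= e / 4.
  have -> : mu * B = e / 4 * (B / (B + 1)) by rewrite /mu; field; lra.
  rewrite ler_piMr //; first lra.
  rewrite ler_pdivrMr; lra.
pose r := e / (2 * (D + 1)).
have r0 : 0 < r by rewrite /r divr_gt0 //; lra.
have rD : r * D <= e / 2.
  have -> : r * D = e / 2 * (D / (D + 1)) by rewrite /r; field; lra.
  rewrite ler_piMr //; first lra.
  rewrite ler_pdivrMr; lra.
pose K := (4 + 2 * M) + 2 / (mu * r) * (2 + M).
have K1 : 0 <= 2 / (mu * r) * (2 + M).
  apply: mulr_ge0; last lra.
  by apply: divr_ge0 => //; apply: mulr_ge0; exact: ltW.
have K0 : 0 < K by rewrite /K; lra.
pose t := Num.min 1 (e / (4 * K)).
have t0 : 0 < t by rewrite /t lt_min ltr01 divr_gt0 //; lra.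
have t1 : t <= 1 by rewrite /t ge_min lexx.
have tK : t * K <= e / 4.
  have : t <= e / (4 * K) by rewrite /t ge_min lexx orbT.
  rewrite ler_pdivlMr; lra.
(* The slack is of second order, so that it is still of order [t] after the division by [t]. *)
pose dl := t * t; have dl0 : 0 < dl by rewrite /dl mulr_gt0.
pose F s p := f s p - mu * nsq p.
have FM s p : S s -> P p -> F s p <= M.
  move=> Ss Pp; have /andP[_ h] := fM _ _ Ss Pp.
  by apply: le_trans h; rewrite /F lerBlDr lerDl mulr_ge0 ?nsq_ge0 // ltW.
pose G s := sup [set F s p | p in P].
have G_ub s p : S s -> P p -> F s p <= G s.
  by move=> Ss; apply: sup_image_ge => ? ?; exact: FM.
have G_adh s : S s -> exists2 p, P p & G s - dl < F s p.
  by move=> Ss; apply: (sup_image_adherent Pp0 _ dl0) => ? ?; exact: FM.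
have G_lb s : S s -> - (mu * B) <= G s.
  move=> Ss; apply: le_addgt0 => x x0; have [p Pp hp] := hS _ _ Ss x0.
  by have := G_ub _ _ Ss Pp; have := PB _ Pp; rewrite /F /f; nra.
have hinf : has_inf [set G s | s in S].
  split; first by exists (G s0), s0.
  by exists (- (mu * B)) => _ [s Ss <-]; exact: G_lb.
set g0 := inf [set G s | s in S].
have g0_lb s : S s -> g0 <= G s.
  by move=> Ss; apply: ge_inf; [case: hinf|exists s].
have [_ [s1 Ss1 <-] Gs1] := inf_adherent dl0 hinf.
have hg0 : - (mu * B) <= g0.
  by apply: lb_le_inf; [case: hinf|move=> _ [s Ss <-]; exact: G_lb].
have [p1 Pp1 Fp1] := G_adh _ Ss1.
exists p1 => // s Ss.
(* Convexity of [S] allows a small step from [s1] towards the given [s]; first-order optimality of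
   [s1] is exploited along it. *)
pose st := ((1 - t)%:C%C *: s1.1 + t%:C%C *: s.1, (1 - t) * s1.2 + t * s.2).
have Sst : S st by apply: Sconv => //; rewrite t1 ltW.
have [pt Ppt Fpt] := G_adh _ Sst.
have Ft : F st pt = F s1 pt + t * (f s pt - f s1 pt).
  by rewrite /F /f /st /= mulmxDl -!scalemxAl rtrD !rtrZ; ring.
have h2 := g0_lb _ Sst; have h4 := G_ub _ _ Ss1 Ppt.
have h5 := G_ub _ _ Ss1 (Pmid _ _ Pp1 Ppt).
have h6 : F s1 ((2^-1)%:C%C *: (p1 + pt)) =
   2^-1 * F s1 p1 + 2^-1 * F s1 pt + mu / 4 * nsq (p1 - pt).
  by rewrite /F /f nsq_midpoint -scalemxAr rtrZ mulmxDr rtrD; field.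
have /andP[a1 a2] := fM _ _ Ss Ppt; have /andP[b1 b2] := fM _ _ Ss1 Ppt.
have bpt : F s1 pt <= f s1 pt.
  by rewrite /F lerBlDr lerDl mulr_ge0 ?nsq_ge0 // ltW.
have hrt := rtr_le_nsq s.1 (pt - p1) r0.
have NE : nsq (pt - p1) = nsq (p1 - pt).
  by rewrite -opprB -scaleN1r -(rmorphN1 (real_complex R)) nsqZ sqrrN expr1n mul1r.
have -> : rtr (s.1 *m p1) + s.2 = f s pt - rtr (s.1 *m (pt - p1)).
  by rewrite /f mulmxBr rtrB; ring.
rewrite h6 in h5; rewrite NE in hrt.
exact: (minimax_estimate e0 mu0 r0 t0 t1 M0 muB rD tK hg0 Gs1 h2 Fpt Fp1 Ft h4 bpt
  h5 a2 b1 (SD _ Ss).1 hrt).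
Qed.

End Minimax.

(** * The trace norm *)
Section TraceNorm.
Context {R : realType}.
Local Notation C := (R[i]).
Local Open Scope classical_set_scope.

Lemma unitary1 n : unitary (1%:M : 'M[C]_n).
Proof. by rewrite /unitary adjmx1 mulmx1. Qed.

Lemma nsq_unitary m n (U : 'M[C]_m) (A : 'M[C]_(m, n)) :
  unitary U -> nsq (U *m A) = nsq A.
Proof.
by move=> uU; rewrite /nsq adjmxM mulmxA rtrC !mulmxA (mulmx1C uU) mul1mx.
Qed.

Lemma rtr_unitary_le m n (U : 'M[C]_m) (A B : 'M[C]_(m, n)) : unitary U ->
  rtr (U *m (A *m adjmx B)) <= (nsq A + nsq B) / 2.
Proof.
move=> uU; have := rtr_le_nsq (U *m A) (adjmx B) ltr01.
by rewrite invr1 !mul1r nsq_unitary // nsq_adj -mulmxA; lra.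
Qed.

Lemma tnorm_ge n (X U : 'M[C]_n) : unitary U -> rtr (U *m X) <= tnorm X.
Proof.
apply: (@sup_image_ge R _ [set V : 'M[C]_n | unitary V] (fun V => rtr (V *m X))
  ((nsq X + nsq (1%:M : 'M[C]_n)) / 2) U) => V uV.
by have := rtr_unitary_le X 1%:M uV; rewrite adjmx1 mulmx1.
Qed.

Lemma tnorm_le n (X : 'M[C]_n) (c : R) :
  (forall U, unitary U -> rtr (U *m X) <= c) -> tnorm X <= c.
Proof. 
move=> h; apply: (@sup_image_le R _ [set V : 'M[C]_n | unitary V]
  (fun V => rtr (V *m X)) c _ (unitary1 n)) => V; exact: h.
 Qed.

Lemma tnorm_ge0 n (X : 'M[C]_n) : 0 <= tnorm X.
Proof.
have h1 := tnorm_ge X (unitary1 n).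
have : unitary (- 1%:M : 'M[C]_n).
  by rewrite /unitary adjmxN adjmx1 mulmxN mulNmx mulmx1 opprK.
move=> /(tnorm_ge X); rewrite mulNmx rtrN mul1mx; rewrite mul1mx in h1; lra.
Qed.

(** One half of the description of the trace norm by factorisations; [tnorm_factor] supplies the
    other half up to an error. The factors are what [tr_idtens_mul_adj] can move onto the Choi
    matrix. *)
Lemma tnorm_mul_adj m n (A B : 'M[C]_(m, n)) :
  tnorm (A *m adjmx B) <= (nsq A + nsq B) / 2.
Proof. by apply: tnorm_le => U; exact: rtr_unitary_le. Qed.

(** In an eigenbasis of [Y] the diagonal of [H] lies between -1 and 1, so replacing [H] by the sign
    of [Y] can only increase the trace. The sign at eigenvalue 0 is taken to be 1, which makes it a
    unitary. *)
Lemma rtr_contraction_le n (H Y : 'M[C]_n) : adjmx Y = Y ->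
  psd (1%:M - H) -> psd (1%:M + H) -> rtr (H *m Y) <= tnorm Y.
Proof.
move=> hY pm pp; have [V [d [uV Yd]]] := hermitian_spectral hY.
have uV' := mulmx1C uV.
pose s : 'rV[R]_n := \row_j (if 0 <= d 0 j then 1 else -1).
have us : unitary (adjmx V *m dgmx s *m V).
  rewrite /unitary !adjmxM adjmxK adjmx_dgmx !mulmxA -(mulmxA _ V) uV mulmx1.
  rewrite -(mulmxA (adjmx V)) dgmxM.
  have -> : \row_j (s 0 j * s 0 j) = const_mx 1.
    by apply/rowP=> j; rewrite !mxE; case: ifP; rewrite ?mulr1 // mulrNN mulr1.
  by rewrite dgmx1 mulmx1.
apply: le_trans (tnorm_ge Y us).
rewrite [in X in _ <= X]Yd !mulmxA -(mulmxA _ V) uV mulmx1.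
rewrite -(mulmxA (adjmx V)) dgmxM [leRHS]rtrC mulmxA uV mul1mx rtr_dgmx.
rewrite Yd mulmxA [leLHS]rtrC !mulmxA [leLHS]rtrC rtr_dgmxM.
apply: ler_sum => j _; rewrite [leRHS]mxE [s 0 j]mxE.
have diag1 (B : 'M[C]_n) : psd B -> 0 <= complex.Re ((V *m B *m adjmx V) j j).
  move=> pB; have [_ /(_ (delta_mx j 0))] := psd_conj V pB.
  by rewrite -/(qf _ _ _) qf_delta => /ge0_Re.
have VV : complex.Re ((V *m 1%:M *m adjmx V) j j) = 1.
  by rewrite mulmx1 uV mxE eqxx.
have := diag1 _ pm; have := diag1 _ pp.
have -> : V *m (1%:M + H) *m adjmx V = V *m 1%:M *m adjmx V + V *m H *m adjmx V.
  by rewrite mulmxDr mulmxDl.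
have -> : V *m (1%:M - H) *m adjmx V = V *m 1%:M *m adjmx V - V *m H *m adjmx V.
  by rewrite mulmxBr mulmxBl.
rewrite [(_ + _ : 'M__) j j]mxE [(_ - _ : 'M__) j j]mxE [(- _ : 'M__) j j]mxE.
rewrite !ReD ReN VV; set x := complex.Re _; move=> h1 h2.
by case: (leP 0 (d 0 j)) => d0; clear -h1 h2 d0; nra.
Qed.

Lemma unitmx_adj n (X : 'M[C]_n) : X \in unitmx -> adjmx X \in unitmx.
Proof. by move=> uX; rewrite /adjmx unitmx_tr map_unitmx. Qed.

Lemma unitary_unitmx n (V : 'M[C]_n) : unitary V -> V \in unitmx.
Proof. by move=> /mulmx1_unit[]. Qed.

(** Up to a change of basis, [B] is [|X|^(1/2)] and [A] is [X |X|^(-1/2)], which have equal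
    Hilbert-Schmidt norms. As [d] lists the eigenvalues of [adjmx X *m X], this calls for fourth
    roots. The common value [Tr |X|] is attained by the unitary [|X|^(-1) *m adjmx X]. *)
Lemma unitmx_polar n (X : 'M[C]_n) : X \in unitmx ->
  exists A B : 'M[C]_n, X = A *m adjmx B /\ (nsq A + nsq B) / 2 <= tnorm X.
Proof.
move=> uX; have [V [d [uV Xd d0]]] := psd_spectral (psd_adj_mulmx X).
have uV' := mulmx1C uV.
have dgd : V *m (adjmx X *m X) *m adjmx V = dgmx d.
  by rewrite Xd !mulmxA uV mul1mx -mulmxA uV mulmx1.
have dpos j : 0 < d 0 j.
  have : dgmx d \in unitmx.
    by rewrite -dgd !unitmx_mul uX (unitmx_adj uX) (unitary_unitmx uV)
      (unitmx_adj (unitary_unitmx uV)).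
  rewrite unitmxE det_diag unitfE => /prodf_neq0 /(_ j isT).
  rewrite mxE => h; rewrite lt_neqAle d0 andbT eq_sym.
  by apply: contra h => /eqP ->; rewrite rmorph0.
have sp j : 0 < Num.sqrt (d 0 j) by rewrite sqrtr_gt0.
have ssp j : 0 < Num.sqrt (Num.sqrt (d 0 j)) by rewrite sqrtr_gt0.
have sqs j : Num.sqrt (d 0 j) * Num.sqrt (d 0 j) = d 0 j.
  by rewrite -expr2 sqr_sqrtr // ltW.
have sqss j : Num.sqrt (Num.sqrt (d 0 j)) * Num.sqrt (Num.sqrt (d 0 j)) = Num.sqrt (d 0 j).
  by rewrite -expr2 sqr_sqrtr // ltW.
pose q : 'rV[R]_n := \row_j Num.sqrt (Num.sqrt (d 0 j)).
pose qi : 'rV[R]_n := \row_j (Num.sqrt (Num.sqrt (d 0 j)))^-1.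
pose si : 'rV[R]_n := \row_j (Num.sqrt (d 0 j))^-1.
pose s : 'rV[R]_n := \row_j Num.sqrt (d 0 j).
have qiq : dgmx qi *m dgmx q = 1%:M.
  rewrite dgmxM -dgmx1; congr dgmx; apply/rowP=> j; rewrite !mxE.
  by rewrite mulVf // gt_eqF.
have qdq : dgmx qi *m dgmx d *m dgmx qi = dgmx s.
  rewrite !dgmxM; congr dgmx; apply/rowP=> j; rewrite !mxE.
  move: (ssp j) (sqss j) (sqs j); set x := Num.sqrt (Num.sqrt _); set y := Num.sqrt _.
  by move=> x0 <- <-; field; rewrite gt_eqF.
have qq : dgmx q *m dgmx q = dgmx s.
  by rewrite dgmxM; congr dgmx; apply/rowP=> j; rewrite !mxE sqss.
have sid : dgmx si *m dgmx d = dgmx s.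
  rewrite dgmxM; congr dgmx; apply/rowP=> j; rewrite !mxE.
  by rewrite -{2}sqs mulrA mulVf ?mul1r // gt_eqF.
have sisi : dgmx s *m dgmx si = 1%:M.
  rewrite dgmxM -dgmx1; congr dgmx; apply/rowP=> j; rewrite !mxE.
  by rewrite mulfV // gt_eqF.
exists (X *m adjmx V *m dgmx qi), (adjmx V *m dgmx q); split.
  by rewrite adjmxM adjmxK adjmx_dgmx -!mulmxA (mulmxA _ _ V) qiq mul1mx uV' mulmx1.
have nA : nsq (X *m adjmx V *m dgmx qi) = rtr (dgmx s).
  rewrite /nsq rtrC !adjmxM adjmxK adjmx_dgmx -qdq -dgd.
  by rewrite !mulmxA.
have nB : nsq (adjmx V *m dgmx q) = rtr (dgmx s).
  by rewrite /nsq rtrC adjmxM adjmxK adjmx_dgmx -mulmxA (mulmxA V) uV mul1mx qq.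
pose U := adjmx V *m dgmx si *m V *m adjmx X.
have uU : unitary U.
  rewrite /unitary /U !adjmxM !adjmxK adjmx_dgmx !mulmxA.
  rewrite -(mulmxA _ (adjmx X)) Xd !mulmxA -(mulmxA _ V (adjmx V)) uV mulmx1.
  rewrite -(mulmxA _ V (adjmx V)) uV mulmx1 -(mulmxA (adjmx V)) sid.
  by rewrite -(mulmxA (adjmx V)) sisi mulmx1 uV'.
apply: le_trans (tnorm_ge X uU).
rewrite /U -(mulmxA _ (adjmx X)) Xd !mulmxA -(mulmxA _ V (adjmx V)) uV mulmx1.
rewrite -(mulmxA (adjmx V)) sid rtrC mulmxA uV mul1mx nA nB.
by rewrite -mulr2n -[_ *+ 2]mulr_natr mulfK ?pnatr_eq0.
Qed.

(** The characteristic polynomial of [- X] has degree [n], so among the [n + 1] distinct points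
    [e / (i + 1)] one is not a root. *)
Lemma unitmx_perturb n (X : 'M[C]_n) (e : R) : 0 < e ->
  exists2 t : R, 0 < t <= e & X + t%:C%C *: 1%:M \in unitmx.
Proof.
move=> e0; pose x i : R := e / i.+1%:R.
have [/hasP[i _ ri]|/hasPn h] := boolP
  (has (fun i => ~~ root (char_poly (- X)) (x i)%:C%C) (iota 0 n.+1)).
  exists (x i).
    rewrite divr_gt0 // ler_piMr ?(ltW e0) // invf_le1 ?ltr0n //.
    by rewrite ler1n.
  rewrite -eigenvalue_root_char negbK /eigenspace in ri.
  have : - X - (x i)%:C%C%:M \in unitmx by rewrite -row_free_unit -kermx_eq0.
  by rewrite -opprD -scaleN1r unitmxZ ?unitrN1 // scalemx1.
have : all (root (char_poly (- X))) [seq (x i)%:C%C | i <- iota 0 n.+1].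
  by apply/allP => _ /mapP[i /h ri ->]; rewrite negbK in ri.
move=> /(max_poly_roots (monic_neq0 (char_poly_monic _))).
rewrite map_inj_uniq ?iota_uniq => [/(_ isT)|i j /complexI].
  by rewrite size_map size_iota size_char_poly ltnn.
move=> /(mulfI (lt0r_neq0 e0)) /invr_inj /eqP.
by rewrite eqr_nat => /eqP [].
Qed.

(* For singular [X] one factors the invertible [X + t 1] and absorbs [- t 1]
   into additional columns. *)
Lemma tnorm_factor n (X : 'M[C]_n) (e : R) : 0 < e ->
  exists A B : 'M[C]_(n, n + n),
    X = A *m adjmx B /\ (nsq A + nsq B) / 2 <= tnorm X + e.
Proof.
(* The shift costs at most [t n] in the trace norm and the extra columns another [t n]; the [+ 1]
   covers [n = 0]. *)
move=> e0; have n0 : 0 < 2 * n%:R + 1 :> R by rewrite ltr_wpDl ?mulr_ge0 ?ler0n.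
have [t /andP[t0 te] uX] := unitmx_perturb X (divr_gt0 e0 n0).
have [A [B [XAB hAB]]] := unitmx_polar uX.
have hs : (Num.sqrt t)%:C%C * (Num.sqrt t)%:C%C = t%:C%C :> C.
  by rewrite -rmorphM -expr2 sqr_sqrtr // ltW.
have hn (a : R) : nsq (a%:C%C *: 1%:M : 'M[C]_n) = a ^+ 2 * n%:R.
  by rewrite nsqZ /nsq adjmx1 mulmx1 rtr1.
have nrow (D E : 'M[C]_n) : nsq (row_mx D E) = nsq D + nsq E.
  rewrite /nsq -rtrD; congr rtr.
  by rewrite /adjmx map_row_mx tr_row_mx mul_row_col.
exists (row_mx A ((- Num.sqrt t)%:C%C *: 1%:M)), (row_mx B ((Num.sqrt t)%:C%C *: 1%:M)).
split.
  rewrite /adjmx map_row_mx tr_row_mx mul_row_col -!/(adjmx _) -XAB adjmxZ adjmx1.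
  by rewrite -scalemxAl mul1mx scalerA rmorphN mulNr hs scaleNr addrK.
rewrite !nrow !hn sqrrN sqr_sqrtr ?(ltW t0) //.
have : tnorm (X + t%:C%C *: 1%:M) <= tnorm X + t * n%:R.
  apply: tnorm_le => U uU; rewrite mulmxDr rtrD -scalemxAr rtrZ.
  have := tnorm_ge X uU; have := rtr_unitary_le 1%:M 1%:M uU.
  rewrite /nsq adjmx1 !mulmx1 rtr1; have := ler0n R n; nra.
have : t * (2 * n%:R + 1) <= e by rewrite -ler_pdivlMr.
lra.
Qed.

End TraceNorm.

(** * Bipartite matrices and linear maps *)
Section Blocks.
Context {R : realType}.
Local Notation C := (R[i]).
Implicit Types (m n r : nat).

Definition tix m n (i : 'I_m) (j : 'I_n) : 'I_(m * n) := mxtens_index (i, j).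

Lemma big_tens m n (V : nmodType) (F : 'I_(m * n) -> V) :
  \sum_k F k = \sum_i \sum_j F (tix i j).
Proof.
rewrite pair_big; apply: (reindex (fun ij => tix ij.1 ij.2)) => /=.
exists (@mxtens_unindex m n) => [[i j] _|k _]; rewrite /tix /= ?mxtens_indexK //.
exact: mxtens_unindexK.
Qed.

Lemma tens_matrixP m n m' n' (A B : 'M[C]_(m * n, m' * n')) :
  (forall i j k l, A (tix i j) (tix k l) = B (tix i j) (tix k l)) -> A = B.
Proof.
move=> h; apply/matrixP=> x y.
by case: (mxtens_indexP x) => i j; case: (mxtens_indexP y) => k l; exact: h.
Qed.

Lemma tens_tixE m n p q (A : 'M[C]_(m, n)) (B : 'M[C]_(p, q)) i j k l :
  (A *t B) (tix i j) (tix k l) = A i k * B j l.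
Proof. exact: tensmxE. Qed.

Definition bl m n (X : 'M[C]_(m * n)) p q : 'M[C]_n :=
  \matrix_(i, j) X (tix p i) (tix q j).

(** Bilinear, without conjugation: for this form [mtrans phi] is the exact adjoint of a hermitian
    [phi]. *)
Definition dotm m n (A B : 'M[C]_(m, n)) : C := \sum_i \sum_j A i j * B i j.

Lemma dotmC m n (A B : 'M[C]_(m, n)) : dotm A B = dotm B A.
Proof. by do 2![apply: eq_bigr => ? _]; rewrite mulrC. Qed.

Lemma dotmDl m n (A A' B : 'M[C]_(m, n)) : dotm (A + A') B = dotm A B + dotm A' B.
Proof.
rewrite -big_split; apply: eq_bigr => i _; rewrite -big_split.
by apply: eq_bigr => j _; rewrite mxE mulrDl.
Qed.

Lemma dotmZl m n a (A B : 'M[C]_(m, n)) : dotm (a *: A) B = a * dotm A B.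
Proof.
rewrite mulr_sumr; apply: eq_bigr => i _; rewrite mulr_sumr.
by apply: eq_bigr => j _; rewrite mxE mulrA.
Qed.

Lemma dotm0l m n (B : 'M[C]_(m, n)) : dotm 0 B = 0.
Proof. by rewrite -(scale0r (0 : 'M_(m, n))) dotmZl mul0r. Qed.

Lemma dotm_suml m n I (s : seq I) (P : pred I) (F : I -> 'M[C]_(m, n)) B :
  dotm (\sum_(i <- s | P i) F i) B = \sum_(i <- s | P i) dotm (F i) B.
Proof.
exact: (big_morph (fun A => dotm A B) (fun A A' => dotmDl A A' B) (dotm0l B)).
Qed.

Lemma dotmZr m n a (A B : 'M[C]_(m, n)) : dotm A (a *: B) = a * dotm A B.
Proof. by rewrite dotmC dotmZl dotmC. Qed.

Lemma dotm_sumr m n I (s : seq I) (P : pred I) (F : I -> 'M[C]_(m, n)) B :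
  dotm B (\sum_(i <- s | P i) F i) = \sum_(i <- s | P i) dotm B (F i).
Proof. by rewrite dotmC dotm_suml; apply: eq_bigr => i _; rewrite dotmC. Qed.

Lemma tr_mulmx_tr m n (A B : 'M[C]_(m, n)) : \tr (A *m B^T) = dotm A B.
Proof.
by apply: eq_bigr => i _; rewrite mxE; apply: eq_bigr => j _; rewrite mxE.
Qed.

Lemma dotm_bl m n (X Y : 'M[C]_(m * n)) :
  dotm X Y = \sum_p \sum_q dotm (bl X p q) (bl Y p q).
Proof.
rewrite /dotm big_tens; apply: eq_bigr => p _ /=; rewrite exchange_big /=.
rewrite exchange_big [in RHS]exchange_big /=; apply: eq_bigr => i _.
rewrite big_tens; apply: eq_bigr => q _; apply: eq_bigr => j _.
by rewrite !mxE.
Qed.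

Lemma bl_conj r m n (A B : 'M[C]_(r, m)) (X : 'M[C]_(m * n)) p q :
  bl ((A *t 1%:M) *m X *m adjmx (B *t 1%:M)) p q =
  \sum_p' \sum_q' (A p p' * conjc (B q q')) *: bl X p' q'.
Proof.
apply/matrixP=> i j; rewrite mxE summxE mxE big_tens exchange_big /=.
rewrite (bigD1 j) //= [X in _ + X]big1 ?addr0 => [|j' /negPf jj']; last first.
  rewrite big1 // => q' _; rewrite adjmxE tens_tixE [1%:M _ _]mxE eq_sym jj' mulr0n mulr0 conjc0.
  by rewrite mulr0.
rewrite (eq_bigr (fun q' => \sum_p' A p p' * conjc (B q q') * X (tix p' i) (tix q' j))).
  rewrite exchange_big; apply: eq_bigr => p' _; rewrite summxE.
  by apply: eq_bigr => q' _; rewrite !mxE.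
move=> q' _; rewrite mxE big_tens exchange_big /= (bigD1 i) //=.
rewrite [X in _ + X]big1 ?addr0 => [|i' /negPf ii']; last first.
  by rewrite big1 // => p' _; rewrite tens_tixE [1%:M _ _]mxE eq_sym ii' mulr0n mulr0 mul0r.
rewrite mulr_suml; apply: eq_bigr => p' _.
by rewrite adjmxE !tens_tixE ![1%:M _ _]mxE !eqxx !mulr1 mulrAC.
Qed.

Lemma blP m n (X Y : 'M[C]_(m * n)) : (forall p q, bl X p q = bl Y p q) -> X = Y.
Proof.
move=> h; apply: tens_matrixP => p i q j.
by have /matrixP /(_ i j) := h p q; rewrite !mxE.
Qed.

End Blocks.

(** * Linear maps, their adjoints and channels *)

Section Maps.
Context {R : realType}.
Local Notation C := (R[i]).
Implicit Types (m n r : nat).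

Lemma linmapD m n (phi : 'M[C]_m -> 'M[C]_n) X Y : linmap phi ->
  phi (X + Y) = phi X + phi Y.
Proof. by move=> l; rewrite -{1}(scale1r X) l scale1r. Qed.

Lemma linmap0 m n (phi : 'M[C]_m -> 'M[C]_n) : linmap phi -> phi 0 = 0.
Proof. by move=> l; apply: (addrI (phi 0)); rewrite -linmapD // !addr0. Qed.

Lemma linmapZ m n (phi : 'M[C]_m -> 'M[C]_n) a X : linmap phi ->
  phi (a *: X) = a *: phi X.
Proof. by move=> l; rewrite -{1}(addr0 (a *: X)) l linmap0 // addr0. Qed.

Lemma linmap_sum m n (phi : 'M[C]_m -> 'M[C]_n) I (s : seq I) (P : pred I) F :
  linmap phi -> phi (\sum_(i <- s | P i) F i) = \sum_(i <- s | P i) phi (F i).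
Proof.
move=> l; apply: (big_morph phi _ (linmap0 l)) => X Y; exact: linmapD.
Qed.

Lemma linmapE m n (phi : 'M[C]_m -> 'M[C]_n) X : linmap phi ->
  phi X = \sum_p \sum_q X p q *: phi (delta_mx p q).
Proof.
move=> l; rewrite {1}[X]matrix_sum_delta linmap_sum //; apply: eq_bigr => p _.
by rewrite linmap_sum //; apply: eq_bigr => q _; rewrite linmapZ.
Qed.

Lemma linmap_comp m n k (phi : 'M[C]_n -> 'M[C]_k) (psi : 'M[C]_m -> 'M[C]_n) :
  linmap phi -> linmap psi -> linmap (phi \o psi).
Proof. by move=> l l' a X Y /=; rewrite l' l. Qed.

Lemma bl_idtens r m n (phi : 'M[C]_m -> 'M[C]_n) (X : 'M[C]_(r * m)) p q :
  bl (idtens phi X) p q = phi (bl X p q).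
Proof.
apply/matrixP=> i j; rewrite !mxE !mxtens_indexK /=.
by congr (phi _ i j); apply/matrixP=> a b; rewrite !mxE.
Qed.

(** The Choi matrix with the input factor first. The same order comes out in [choi (hsadj phi)], so
    [choi_hsadj] relates the two without a swap of factors. *)
Definition Jmx m n (phi : 'M[C]_m -> 'M[C]_n) : 'M[C]_(m * n) :=
  idtens phi (maxent m).

Lemma bl_maxent m p q : bl (maxent m : 'M[C]_(m * m)) p q = delta_mx p q.
Proof.
apply/matrixP=> i j; rewrite !mxE !mxtens_indexK /= [p == i]eq_sym.
by rewrite [q == j]eq_sym.
Qed.

Lemma bl_Jmx m n (phi : 'M[C]_m -> 'M[C]_n) p q : bl (Jmx phi) p q = phi (delta_mx p q).
Proof. by rewrite bl_idtens bl_maxent. Qed.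

Lemma JmxE m n (phi : 'M[C]_m -> 'M[C]_n) p i q j :
  Jmx phi (tix p i) (tix q j) = phi (delta_mx p q) i j.
Proof. by rewrite -(bl_Jmx phi) [RHS]mxE. Qed.

Definition hpmap m n (phi : 'M[C]_m -> 'M[C]_n) : Prop := adjmx (Jmx phi) = Jmx phi.

Lemma choi_hsadj m n (phi : 'M[C]_m -> 'M[C]_n) :
  choi (hsadj phi) = (adjmx (Jmx phi))^T.
Proof.
apply: tens_matrixP => p i q j; rewrite [RHS]mxE adjmxE JmxE !mxE !mxtens_indexK /=.
set X := (X in _ *m X); have -> : X = delta_mx i j.
  apply/matrixP=> a b; rewrite !mxE !mxtens_indexK /= .
  by case: eqP; case: eqP.
rewrite mxtrace_mulC /mxtrace (bigD1 i) //= big1 ?addr0 => [|k /negPf ki]; last first.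
  by rewrite mxE big1 // => l _; rewrite mxE ki mul0r.
rewrite mxE (bigD1 j) //= big1 ?addr0 => [|k /negPf kj]; last first.
  by rewrite mxE kj andbF mul0r.
by rewrite mxE !eqxx mul1r adjmxE.
Qed.

Lemma choi_hsadj_hp m n (phi : 'M[C]_m -> 'M[C]_n) : hpmap phi ->
  choi (hsadj phi) = (Jmx phi)^T.
Proof. by rewrite choi_hsadj => ->. Qed.

Lemma pairing_bl m n (X : 'M[C]_(m * n)) (phi : 'M[C]_m -> 'M[C]_n) : hpmap phi ->
  pairing X phi = \sum_p \sum_q dotm (bl X p q) (phi (delta_mx p q)).
Proof.
move=> h; rewrite /pairing choi_hsadj_hp // tr_mulmx_tr dotm_bl.
by do 2![apply: eq_bigr => ? _]; rewrite bl_Jmx.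
Qed.

Lemma psd_maxent m : psd (maxent m : 'M[C]_(m * m)).
Proof.
pose w : 'cV[C]_(m * m) :=
  \col_k ((mxtens_unindex k).1 == (mxtens_unindex k).2)%:R.
suff -> : maxent m = w *m adjmx w by exact: psd_mulmx_adj.
apply/matrixP=> k l; rewrite [RHS]mxE big_ord1 !mxE.
by case: eqP; case: eqP; rewrite ?conjc1 ?conjc0 ?mulr1 ?mulr0 ?mul0r.
Qed.

Lemma psd_Jmx m n (phi : 'M[C]_m -> 'M[C]_n) : cpmap phi -> psd (Jmx phi).
Proof. by move=> h; apply: h; exact: psd_maxent. Qed.

Lemma channel_hp m n (phi : 'M[C]_m -> 'M[C]_n) : channel phi -> hpmap phi.
Proof. by move=> [_ /psd_Jmx[]]. Qed.

Lemma channel_lin m n (phi : 'M[C]_m -> 'M[C]_n) : channel phi -> linmap phi.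
Proof. by case. Qed.

Lemma psd_choi_hsadj m n (phi : 'M[C]_m -> 'M[C]_n) : channel phi ->
  psd (choi (hsadj phi)).
Proof.
move=> h; rewrite choi_hsadj_hp; last exact: channel_hp.
by apply/psd_tr/psd_Jmx; case: h.
Qed.

Lemma hpmapE m n (phi : 'M[C]_m -> 'M[C]_n) p q i j : hpmap phi ->
  conjc (phi (delta_mx p q) i j) = phi (delta_mx q p) j i.
Proof. by move=> h; rewrite -!JmxE -adjmxE h. Qed.

(** The two transposes in [mtrans] undo the conjugation built into [hsadj] as soon as [phi]
    preserves hermiticity. *)
Lemma dotm_mtrans m n (phi : 'M[C]_m -> 'M[C]_n) Z Y : linmap phi -> hpmap phi ->
  dotm (mtrans phi Z) Y = dotm Z (phi Y).
Proof.
move=> l h; rewrite (linmapE Y l) dotm_sumr; apply: eq_bigr => i _.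
rewrite dotm_sumr; apply: eq_bigr => j _; rewrite dotmZr mulrC; congr (_ * _).
rewrite !mxE -tr_mulmx_tr -[LHS]mxtrace_tr trmx_mul trmxK; congr (\tr (_ *m _)).
by apply/matrixP=> a b; rewrite !mxE hpmapE.
Qed.

Lemma pairing_idtens_mtrans r m n (phi : 'M[C]_m -> 'M[C]_n)
    (al : 'M[C]_r -> 'M[C]_m) rho : linmap phi -> hpmap phi -> hpmap al ->
  hpmap (phi \o al) ->
  pairing (idtens (mtrans phi) rho) al = pairing rho (phi \o al).
Proof.
move=> l h h' hc; rewrite !pairing_bl //.
by do 2![apply: eq_bigr => ? _]; rewrite bl_idtens dotm_mtrans.
Qed.

Lemma idtens_comp r m n k (phi : 'M[C]_n -> 'M[C]_k) (psi : 'M[C]_m -> 'M[C]_n)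
    (X : 'M[C]_(r * m)) :
  idtens (phi \o psi) X = idtens phi (idtens psi X).
Proof. by apply: blP => p q; rewrite !bl_idtens. Qed.

Lemma channel_comp m n k (phi : 'M[C]_n -> 'M[C]_k) (psi : 'M[C]_m -> 'M[C]_n) :
  channel phi -> channel psi -> channel (phi \o psi).
Proof.
move=> [l c t] [l' c' t']; split; first exact: linmap_comp.
  by move=> r X pX; rewrite idtens_comp; apply: c; apply: c'.
by move=> X /=; rewrite t t'.
Qed.

Lemma channel_id m : channel (@id 'M[C]_m).
Proof.
split=> // r X pX; suff -> : idtens id X = X by [].
by apply: blP => p q; rewrite bl_idtens.
Qed.

Lemma channel_mix m n (phi psi : 'M[C]_m -> 'M[C]_n) (t : R) : 0 <= t <= 1 ->
  channel phi -> channel psi ->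
  channel (fun X => (1 - t)%:C%C *: phi X + t%:C%C *: psi X).
Proof.
move=> /andP[t0 t1] [l c tp] [l' c' tp']; split.
- move=> a X Y; rewrite l l' !scalerDr !scalerA ![a * _]mulrC.
  by rewrite addrACA.
- move=> r X pX.
  have -> : idtens (fun X => (1 - t)%:C%C *: phi X + t%:C%C *: psi X) X =
    (1 - t)%:C%C *: idtens phi X + t%:C%C *: idtens psi X.
    apply: tens_matrixP => p i q j; by rewrite !mxE !mxtens_indexK /=.
  by apply: psdD; apply: psdZ; rewrite ?subr_ge0 //; [exact: c|exact: c'].
- move=> X; rewrite mxtraceD !mxtraceZ tp tp' -mulrDl -rmorphD subrK.
  by rewrite rmorph1 mul1r.
Qed.

End Maps.

(** * Link product, marginals and Choi matrices *)
Section Link.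
Context {R : realType}.
Local Notation C := (R[i]).
Implicit Types (m n r : nat).

Lemma big_exchange22 (V : nmodType) (I J K L : finType) (F : I -> J -> K -> L -> V) :
  \sum_i \sum_j \sum_k \sum_l F i j k l = \sum_k \sum_l \sum_i \sum_j F i j k l.
Proof.
rewrite (eq_bigr (fun i => \sum_k \sum_j \sum_l F i j k l)); last first.
  by move=> i _; rewrite exchange_big.
rewrite exchange_big; apply: eq_bigr => k _.
rewrite [RHS]exchange_big; apply: eq_bigr => i _.
exact: exchange_big.
Qed.

Lemma mx1tens_conjE r m n (A : 'M[C]_(n, m)) (X : 'M[C]_(r * m)) p i q j :
  ((1%:M *t A) *m X *m adjmx (1%:M *t A)) (tix p i) (tix q j) =
  \sum_a \sum_b A i a * X (tix p a) (tix q b) * conjc (A j b).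
Proof.
rewrite mxE big_tens (bigD1 q) //= [X in _ + X]big1 ?addr0 => [|q' /negPf qq']; last first.
  rewrite big1 // => b _; rewrite adjmxE tens_tixE [1%:M _ _]mxE eq_sym qq' mulr0n.
  by rewrite mul0r conjc0 mulr0.
rewrite exchange_big; apply: eq_bigr => b _.
rewrite adjmxE tens_tixE [1%:M _ _]mxE eqxx mul1r -mulr_suml; congr (_ * _).
rewrite mxE big_tens (bigD1 p) //= [X in _ + X]big1 ?addr0 => [|p' /negPf pp']; last first.
  by rewrite big1 // => a _; rewrite tens_tixE [1%:M _ _]mxE eq_sym pp' mulr0n !mul0r.
by apply: eq_bigr => a _; rewrite tens_tixE [1%:M _ _]mxE eqxx mul1r.
Qed.

(** Contraction over the shared middle factor, with no transpose on either side. Applying a map is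
    the link with its Choi matrix ([idtens_link]); pulling an operator back along a channel and
    contracting it with a measurement are links as well, so one positivity lemma serves all
    three. *)
Definition link m k n (X : 'M[C]_(m * k)) (Y : 'M[C]_(k * n)) : 'M[C]_(m * n) :=
  \matrix_(u, v) \sum_a \sum_b
    X (tix (mxtens_unindex u).1 a) (tix (mxtens_unindex v).1 b) *
    Y (tix a (mxtens_unindex u).2) (tix b (mxtens_unindex v).2).

Lemma linkE m k n (X : 'M[C]_(m * k)) (Y : 'M[C]_(k * n)) p i q j :
  link X Y (tix p i) (tix q j) =
  \sum_a \sum_b X (tix p a) (tix q b) * Y (tix a i) (tix b j).
Proof. by rewrite mxE !mxtens_indexK. Qed.

Lemma bl_link m k n (X : 'M[C]_(m * k)) (Y : 'M[C]_(k * n)) p q :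
  bl (link X Y) p q = \sum_a \sum_b X (tix p a) (tix q b) *: bl Y a b.
Proof.
apply/matrixP=> i j; rewrite mxE linkE summxE; apply: eq_bigr => a _.
by rewrite summxE; apply: eq_bigr => b _; rewrite !mxE.
Qed.

(* A factorisation of [Y] yields Kraus operators for [link ^~ Y]. *)
Lemma psd_link m k n (X : 'M[C]_(m * k)) (Y : 'M[C]_(k * n)) :
  psd X -> psd Y -> psd (link X Y).
Proof.
move=> pX /psd_factor[B YB].
pose E c : 'M[C]_(m * n, m * k) := 1%:M *t (\matrix_(i, a) B (tix a i) c).
suff -> : link X Y = \sum_c E c *m X *m adjmx (E c).
  by apply: psd_sum => c _; exact: psd_conj.
apply: tens_matrixP => p i q j; rewrite linkE summxE.
under [RHS]eq_bigr => c _ do rewrite mx1tens_conjE.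
rewrite [RHS]exchange_big; apply: eq_bigr => a _.
rewrite [RHS]exchange_big; apply: eq_bigr => b _.
rewrite YB mxE mulr_sumr; apply: eq_bigr => c _.
by rewrite !mxE mulrCA mulrA.
Qed.

Lemma idtens_link r m n (phi : 'M[C]_m -> 'M[C]_n) (X : 'M[C]_(r * m)) :
  linmap phi -> idtens phi X = link X (Jmx phi).
Proof.
move=> l; apply: blP => p q; rewrite bl_idtens bl_link (linmapE _ l).
by apply: eq_bigr => a _; apply: eq_bigr => b _; rewrite mxE bl_Jmx.
Qed.

Lemma psd_mxsub m n (f : 'I_m -> 'I_n) (X : 'M[C]_n) : psd X -> psd (mxsub f f X).
Proof.
move=> pX; suff -> : mxsub f f X = rowsub f 1%:M *m X *m adjmx (rowsub f 1%:M).
  exact: psd_conj.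
have -> : adjmx (rowsub f 1%:M) = colsub f 1%:M :> 'M[C]_(n, m).
  apply/matrixP=> i j; rewrite adjmxE !mxE eq_sym; case: eqP => _.
    by rewrite conjc1.
  by rewrite conjc0.
rewrite mul_rowsub_mx mul1mx mulmx_colsub mulmx1.
by apply/matrixP=> i j; rewrite !mxE.
Qed.

Definition tswap m n (u : 'I_(m * n)) : 'I_(n * m) :=
  tix (mxtens_unindex u).2 (mxtens_unindex u).1.

Definition swapmx m n (X : 'M[C]_(m * n)) : 'M[C]_(n * m) :=
  mxsub (@tswap n m) (@tswap n m) X.

Lemma tswapE m n i j : @tswap m n (tix i j) = tix j i.
Proof. by rewrite /tswap /tix mxtens_indexK. Qed.

Lemma swapmxE m n (X : 'M[C]_(m * n)) i j k l :
  swapmx X (tix i j) (tix k l) = X (tix j i) (tix l k).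
Proof. by rewrite mxE !tswapE. Qed.

Lemma psd_swapmx m n (X : 'M[C]_(m * n)) : psd X -> psd (swapmx X).
Proof. exact: psd_mxsub. Qed.

Lemma dotm_swapmx m n (A : 'M[C]_(m * n)) (B : 'M[C]_(n * m)) :
  dotm (swapmx A) B = dotm A (swapmx B).
Proof.
rewrite /dotm !big_tens exchange_big; apply: eq_bigr => i _; apply: eq_bigr => j _.
rewrite !big_tens exchange_big; apply: eq_bigr => k _; apply: eq_bigr => l _.
by rewrite !swapmxE.
Qed.

Lemma tensid_swap k m n (phi : 'M[C]_m -> 'M[C]_n) (X : 'M[C]_(m * k)) :
  tensid phi X = swapmx (idtens phi (swapmx X)).
Proof.
apply: tens_matrixP => i a j b; rewrite swapmxE !mxE !mxtens_indexK /=.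
by congr (phi _ i j); apply/matrixP=> p q; rewrite !mxE -!/(tix _ _) !tswapE.
Qed.

(** Summing over the kept factor first merges state and measurement into one operator on the input
    and output of [g]; a success probability thereby becomes a pairing with [g]. *)
Lemma tr_tensid k m n (g : 'M[C]_m -> 'M[C]_n) (X : 'M[C]_(m * k)) (M : 'M[C]_(n * k)) :
  linmap g -> hpmap g ->
  \tr (tensid g X *m M) = pairing (link X (swapmx M)^T) g.
Proof.
move=> l h; rewrite -[M in LHS]trmxK tr_mulmx_tr tensid_swap dotm_swapmx dotm_bl.
rewrite pairing_bl //.
under [RHS]eq_bigr => p _ do under eq_bigr => q _ do rewrite bl_link dotm_suml.
under [RHS]eq_bigr => p _ do under eq_bigr => q _ do
  under eq_bigr => a _ do rewrite dotm_suml.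
rewrite [RHS]big_exchange22; apply: eq_bigr => a _; apply: eq_bigr => b _.
rewrite bl_idtens (linmapE _ l) dotm_suml; apply: eq_bigr => p _.
rewrite dotm_suml; apply: eq_bigr => q _; rewrite !dotmZl mxE swapmxE; congr (_ * _).
by rewrite dotmC; congr dotm; apply/matrixP=> i j; rewrite !mxE.
Qed.

(** Absorbing [al] into the operator trades an arbitrary ancilla for the input space of [psi]. *)
Lemma pairing_pull r m n (psi : 'M[C]_m -> 'M[C]_n) (al : 'M[C]_r -> 'M[C]_m) rho :
  linmap psi -> hpmap psi -> hpmap (psi \o al) ->
  pairing rho (psi \o al) = pairing (link (swapmx (Jmx al)) rho) psi.
Proof.
move=> l h hc; rewrite !pairing_bl //.
under [RHS]eq_bigr => p _ do under eq_bigr => q _ do rewrite bl_link dotm_suml.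
under [RHS]eq_bigr => p _ do under eq_bigr => q _ do
  under eq_bigr => a _ do rewrite dotm_suml.
rewrite [RHS]big_exchange22; apply: eq_bigr => a _; apply: eq_bigr => b _ /=.
rewrite (linmapE _ l) dotm_sumr; apply: eq_bigr => p _.
rewrite dotm_sumr; apply: eq_bigr => q _.
by rewrite dotmZl dotmZr swapmxE JmxE.
Qed.

Definition ptr2 m n (Z : 'M[C]_(m * n)) : 'M[C]_m := \matrix_(p, q) \tr (bl Z p q).

Lemma ptr2D m n (Z Z' : 'M[C]_(m * n)) : ptr2 (Z + Z') = ptr2 Z + ptr2 Z'.
Proof.
apply/matrixP=> p q; rewrite !mxE -mxtraceD; congr (\tr _).
by apply/matrixP=> i j; rewrite !mxE.
Qed.

Lemma ptr2_tens m n (A : 'M[C]_m) (B : 'M[C]_n) : ptr2 (A *t B) = \tr B *: A.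
Proof.
apply/matrixP=> p q; rewrite !mxE mulr_suml; apply: eq_bigr => i _.
by rewrite mxE tens_tixE mulrC.
Qed.

Lemma tr_tens1 m n (s : 'M[C]_m) (Z : 'M[C]_(m * n)) :
  \tr ((s *t 1%:M) *m Z) = \tr (s *m ptr2 Z).
Proof.
rewrite -[Z in LHS]trmxK tr_mulmx_tr dotm_bl /mxtrace; apply: eq_bigr => p _.
rewrite mxE; apply: eq_bigr => q _.
rewrite mxE mulr_sumr; apply: eq_bigr => i _.
rewrite (bigD1 i) //= big1 ?addr0 => [|j /negPf ij]; last first.
  by rewrite mxE tens_tixE [1%:M _ _]mxE eq_sym ij mulr0n mulr0 mul0r.
by rewrite ![bl _ _ _ _ _]mxE [Z^T _ _]mxE tens_tixE [1%:M _ _]mxE eqxx mulr1.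
Qed.

Lemma psd_tens1 m n (s : 'M[C]_m) : psd s -> psd (s *t (1%:M : 'M[C]_n)).
Proof.
move=> /psd_factor[B ->]; rewrite -[1%:M]mulmx1 -tensmx_mul -{2}(adjmx1 n).
by rewrite -adjmx_tens; exact: psd_mulmx_adj.
Qed.

Lemma tens11 m n : (1%:M : 'M[C]_m) *t (1%:M : 'M[C]_n) = 1%:M.
Proof.
apply: tens_matrixP => i j k l; rewrite tens_tixE !mxE -natrM mulnb.
by rewrite (inj_eq (can_inj (@mxtens_indexK m n))) xpair_eqE.
Qed.

Lemma psd_ptr2 m n (Z : 'M[C]_(m * n)) : psd Z -> psd (ptr2 Z).
Proof.
move=> pZ; apply: psd_qf => v.
have -> : qf (ptr2 Z) v v = \tr ((v *m adjmx v) *m ptr2 Z).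
  by rewrite mxtrace_mulC mulmxA mxtrace_mulC mulmxA /mxtrace big_ord1.
rewrite -tr_tens1; apply: psd_tr_ge0 => //.
by apply: psd_tens1; exact: psd_mulmx_adj.
Qed.

(** Channels have [c = 1], differences of channels [c = 0]; the second case is the vanishing
    marginal. *)
Lemma ptr2_choi_hsadj m n (phi : 'M[C]_m -> 'M[C]_n) (c : C) : 
  (forall X, \tr (phi X) = c * \tr X) ->
  ptr2 (choi (hsadj phi)) = conjc c *: 1%:M.
Proof.
move=> h; apply/matrixP=> p q; rewrite choi_hsadj !mxE.
transitivity (conjc (\tr (phi (delta_mx p q)))).
  rewrite /mxtrace conjc_sum; apply: eq_bigr => i _.
  by rewrite 2!mxE adjmxE JmxE.
rewrite h conjcM; congr (_ * _).
rewrite /mxtrace (bigD1 p) //= mxE eqxx /= big1 ?addr0 => [|i /negPf ip]; last first.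
  by rewrite mxE ip.
by case: (p == q); rewrite ?conjc1 ?conjc0.
Qed.

Lemma tr_tens1_choi m n (phi : 'M[C]_m -> 'M[C]_n) s : tpmap phi ->
  \tr ((s *t 1%:M) *m choi (hsadj phi)) = \tr s.
Proof.
move=> t; rewrite tr_tens1 (@ptr2_choi_hsadj _ _ _ 1) ?conjc1 ?scale1r ?mulmx1 //.
by move=> X; rewrite mul1r t.
Qed.

(** Inverse of the Choi correspondence. The indices of [Z] are transposed because [Z] is meant to be
    the Choi matrix of the adjoint of the map. *)
Definition channel_of m n (Z : 'M[C]_(m * n)) (Y : 'M[C]_m) : 'M[C]_n :=
  \matrix_(i, j) \sum_p \sum_q Y p q * Z (tix q j) (tix p i).

Lemma linmap_channel_of m n (Z : 'M[C]_(m * n)) : linmap (channel_of Z).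
Proof.
move=> a X Y; apply/matrixP=> i j; rewrite !mxE mulr_sumr -big_split /=.
apply: eq_bigr => p _; rewrite mulr_sumr -big_split /=; apply: eq_bigr => q _.
by rewrite !mxE mulrDl mulrA.
Qed.

Lemma Jmx_channel_of m n (Z : 'M[C]_(m * n)) : Jmx (channel_of Z) = Z^T.
Proof.
apply: tens_matrixP => p i q j; rewrite JmxE !mxE.
rewrite (bigD1 p) //= [X in _ + X]big1 ?addr0 => [|p' /negPf pp']; last first.
  by rewrite big1 // => q' _; rewrite mxE pp' mul0r.
rewrite (bigD1 q) //= [X in _ + X]big1 ?addr0 => [|q' /negPf qq']; last first.
  by rewrite mxE qq' andbF mul0r.
by rewrite mxE !eqxx mul1r.
Qed.

Lemma channel_ofP m n (Z : 'M[C]_(m * n)) : psd Z -> ptr2 Z = 1%:M ->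
  channel (channel_of Z) /\ choi (hsadj (channel_of Z)) = Z.
Proof.
move=> pZ tZ; have lZ := linmap_channel_of Z.
have cZ : channel (channel_of Z).
  split=> // [r X pX|X].
    rewrite idtens_link // Jmx_channel_of; apply: psd_link => //.
    exact: psd_tr.
  rewrite /mxtrace; under eq_bigr => i _ do rewrite mxE.
  rewrite exchange_big; apply: eq_bigr => p _ /=.
  rewrite exchange_big (bigD1 p) //= [X in _ + X]big1 ?addr0 => [|q /negPf qp].
    rewrite -mulr_sumr; have /matrixP /(_ p p) := tZ.
    rewrite !mxE eqxx /mxtrace => h; rewrite -[RHS]mulr1; congr (_ * _).
    by rewrite -[RHS]h; apply: eq_bigr => i _; rewrite mxE.
  rewrite -mulr_sumr; have /matrixP /(_ q p) := tZ.
  rewrite !mxE qp /mxtrace => h; rewrite -[RHS](mulr0 (X p q)); congr (_ * _).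
  by rewrite -[RHS]h; apply: eq_bigr => i _; rewrite mxE.
split=> //; rewrite choi_hsadj_hp ?Jmx_channel_of ?trmxK //; exact: channel_hp.
Qed.

(** The missing marginal [1 - ptr2 Z] is supplied by a maximally mixed output, which turns the
    inequality into the exact normalisation of a channel. *)
Lemma channel_ge m n (Z : 'M[C]_(m * n)) : (0 < n)%N -> psd Z ->
  psd (1%:M - ptr2 Z) ->
  exists2 g : 'M[C]_m -> 'M[C]_n, channel g & psd (choi (hsadj g) - Z).
Proof.
move=> n0 pZ p1; pose D := (n%:R^-1)%:C%C *: ((1%:M - ptr2 Z) *t (1%:M : 'M[C]_n)).
have pD : psd D by apply: psdZ; rewrite ?invr_ge0 ?ler0n //; exact: psd_tens1.
have tD : ptr2 D = 1%:M - ptr2 Z.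
  have -> : D = (1%:M - ptr2 Z) *t ((n%:R^-1)%:C%C *: (1%:M : 'M[C]_n)).
    by apply: tens_matrixP => p i q j; rewrite !mxE !mxtens_indexK /= mulrCA.
  rewrite ptr2_tens mxtraceZ mxtrace1 -(rmorph_nat (real_complex R)) -rmorphM.
  by rewrite mulVf ?rmorph1 ?scale1r // pnatr_eq0 -lt0n.
have [|cg eg] := @channel_ofP _ _ (Z + D) (psdD pZ pD).
  by rewrite ptr2D tD addrC subrK.
by exists (channel_of (Z + D)) => //; rewrite eg addrAC subrr add0r.
Qed.

Lemma channel_exists m n : (0 < n)%N -> exists g : 'M[C]_m -> 'M[C]_n, channel g.
Proof.
move=> n0; have [|g cg _] := @channel_ge m n 0 n0 (psd0 _); last by exists g.
suff -> : ptr2 (0 : 'M[C]_(m * n)) = 0 by rewrite subr0; exact: psd1.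
apply/matrixP=> p q; rewrite !mxE /mxtrace big1 // => i _.
by rewrite !mxE.
Qed.

Lemma idtens_conj r m n k (phi : 'M[C]_m -> 'M[C]_n) (A B : 'M[C]_(r, k))
    (X : 'M[C]_(k * m)) : linmap phi ->
  idtens phi ((A *t 1%:M) *m X *m adjmx (B *t 1%:M)) =
  (A *t 1%:M) *m idtens phi X *m adjmx (B *t 1%:M).
Proof.
move=> l; apply: blP => p q; rewrite bl_idtens !bl_conj linmap_sum //.
apply: eq_bigr => p' _; rewrite linmap_sum //; apply: eq_bigr => q' _.
by rewrite linmapZ // bl_idtens.
Qed.

Definition unvec r m N (A : 'M[C]_(r * m, N)) c : 'M[C]_(m, r) :=
  \matrix_(a, p) A (tix p a) c.

(** Every column is the vector [|I>>] acted on by a matrix on the first factor, and such a matrix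
    commutes with a map applied to the second. *)
Lemma mul_adj_unvec r m N (A B : 'M[C]_(r * m, N)) :
  A *m adjmx B = \sum_c ((unvec A c)^T *t 1%:M) *m maxent m
                     *m adjmx ((unvec B c)^T *t 1%:M).
Proof.
apply: blP => p q; apply/matrixP=> a b; rewrite mxE mxE.
rewrite [RHS]mxE summxE; apply: eq_bigr => c _.
have /matrixP /(_ a b) := bl_conj (unvec A c)^T (unvec B c)^T (maxent m) p q.
rewrite mxE => ->; rewrite summxE (bigD1 a) //= [X in _ + X]big1 ?addr0; last first.
  move=> a' /negPf aa'; rewrite summxE big1 // => b' _.
  by rewrite bl_maxent !mxE eq_sym aa' mulr0.
rewrite summxE (bigD1 b) //= [X in _ + X]big1 ?addr0; last first.
  by move=> b' /negPf bb'; rewrite bl_maxent !mxE [b == _]eq_sym bb' andbF mulr0.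
by rewrite bl_maxent adjmxE !mxE !eqxx mulr1.
Qed.

(** Transposition carries the ancilla part of the input over to the test side, leaving an operator
    on [m * n] however large [r] is. *)
Lemma tr_idtens_mul_adj r m n N (psi : 'M[C]_m -> 'M[C]_n) (U : 'M[C]_(r * n))
    (A B : 'M[C]_(r * m, N)) : linmap psi -> hpmap psi ->
  \tr (U *m idtens psi (A *m adjmx B)) =
  \tr ((\sum_c (unvec A c *t 1%:M) *m U^T *m adjmx (unvec B c *t 1%:M))
       *m choi (hsadj psi)).
Proof.
move=> l h; rewrite mul_adj_unvec.
have -> : idtens psi (\sum_c (((unvec A c)^T *t 1%:M) *m maxent m
    *m adjmx ((unvec B c)^T *t 1%:M))) =
  \sum_c (((unvec A c)^T *t 1%:M) *m Jmx psi *m adjmx ((unvec B c)^T *t 1%:M)).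
  under [RHS]eq_bigr => c _ do rewrite -idtens_conj //.
  apply: blP => p q; rewrite bl_idtens; apply/matrixP=> i j.
  rewrite mxE summxE.
  have -> : bl (\sum_c ((unvec A c)^T *t 1%:M *m maxent m *m adjmx ((unvec B c)^T *t 1%:M))) p q
    = \sum_c bl ((unvec A c)^T *t 1%:M *m maxent m *m adjmx ((unvec B c)^T *t 1%:M)) p q.
    by apply/matrixP=> a b; rewrite mxE !summxE; apply: eq_bigr => c _; rewrite [RHS]mxE.
  rewrite linmap_sum // summxE; apply: eq_bigr => c _.
  by rewrite -bl_idtens mxE.
rewrite choi_hsadj_hp // mulmx_sumr mulmx_suml !linear_sum /=.
apply: eq_bigr => c _.
rewrite -[RHS]mxtrace_tr !trmx_mul -adjmx_tr !trmx_tens !trmx1.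
rewrite [(Jmx psi)^T^T]trmxK [U^T^T]trmxK.
set X := adjmx _; set Y := _^T *t _.
by rewrite !mulmxA -[in RHS](mulmxA (Jmx psi *m X)) [RHS]mxtrace_mulC !mulmxA.
Qed.

End Link.

(** * The diamond norm of a difference of channels *)
Section Diamond.
Context {R : realType}.
Local Notation C := (R[i]).
Local Open Scope classical_set_scope.
Implicit Types (m n r : nat).

Lemma nsq_unvec r m N (A : 'M[C]_(r * m, N)) : \sum_c nsq (unvec A c) = nsq A.
Proof.
rewrite [RHS]nsqE big_tens.
under [RHS]eq_bigr => p _ do rewrite exchange_big.
rewrite [RHS]exchange_big; apply: eq_bigr => c _.
rewrite nsqE exchange_big; apply: eq_bigr => p _; apply: eq_bigr => a _.
by rewrite mxE.
Qed.

Lemma tens1D m n (A B : 'M[C]_m) : (A + B) *t (1%:M : 'M[C]_n) = A *t 1%:M + B *t 1%:M.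
Proof. by apply: tens_matrixP => p i q j; rewrite !mxE mulrDl. Qed.

Lemma tens1Z m n a (A : 'M[C]_m) : (a *: A) *t (1%:M : 'M[C]_n) = a *: (A *t 1%:M).
Proof. by apply: tens_matrixP => p i q j; rewrite !mxE mulrA. Qed.

Lemma tens1_sum m n I (s : seq I) (P : pred I) (F : I -> 'M[C]_m) :
  (\sum_(i <- s | P i) F i) *t (1%:M : 'M[C]_n) = \sum_(i <- s | P i) F i *t 1%:M.
Proof.
exact: (big_morph (fun A => A *t 1%:M) (@tens1D m n) (tens0mx 1%:M)).
Qed.

Lemma tens1M m n k l (A : 'M[C]_(m, n)) (B : 'M[C]_(n, k)) :
  (A *m B) *t (1%:M : 'M[C]_l) = (A *t 1%:M) *m (B *t 1%:M).
Proof. by rewrite tensmx_mul mulmx1. Qed.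

Lemma adjmx_tens1 m n l (A : 'M[C]_(m, n)) :
  adjmx (A *t (1%:M : 'M[C]_l)) = adjmx A *t 1%:M.
Proof. by rewrite adjmx_tens adjmx1. Qed.

Lemma unitary_tr n (U : 'M[C]_n) : unitary U -> unitary U^T.
Proof.
move=> uU; rewrite /unitary adjmx_tr -trmx_mul.
by rewrite (mulmx1C uU) trmx1.
Qed.

(** Both are sums of squares, of [K c *m V + L c] and of [K c *m V - L c]; unitarity removes [V]
    from the terms in [K] alone. *)
Lemma psd_sandwichDB m n N (K L : 'I_N -> 'M[C]_(m, n)) (V : 'M[C]_n) :
  unitary V ->
  let Y := \sum_c K c *m V *m adjmx (L c) in
  let S2 := \sum_c (K c *m adjmx (K c) + L c *m adjmx (L c)) in
  psd (S2 + (Y + adjmx Y)) /\ psd (S2 - (Y + adjmx Y)).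
Proof.
move=> uV Y S2.
have E (L' : 'I_N -> 'M[C]_(m, n)) :
  \sum_c (K c *m V + L' c) *m adjmx (K c *m V + L' c) =
  \sum_c (K c *m adjmx (K c) + L' c *m adjmx (L' c)) +
  (\sum_c K c *m V *m adjmx (L' c) + adjmx (\sum_c K c *m V *m adjmx (L' c))).
  rewrite adjmx_sum -!big_split /=; apply: eq_bigr => c _.
  rewrite adjmxD mulmxDl !mulmxDr !adjmxM adjmxK.
  have -> : K c *m V *m (adjmx V *m adjmx (K c)) = K c *m adjmx (K c).
    by rewrite mulmxA -(mulmxA _ V) uV mulmx1.
  rewrite -!addrA; congr (_ + _).
  rewrite addrA addrC ?mulmxA.
  by first [rewrite -[LHS]addrA [LHS]addrC | rewrite -[RHS]addrA [RHS]addrC].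
split.
  by rewrite /S2 /Y -E; apply: psd_sum => c _; exact: psd_mulmx_adj.
have -> : S2 - (Y + adjmx Y) = \sum_c (K c *m V - L c) *m adjmx (K c *m V - L c).
  rewrite E; congr (_ + _).
    by apply: eq_bigr => c _; rewrite adjmxN mulmxN mulNmx opprK.
  have -> : \sum_c K c *m V *m adjmx (- L c) = - Y.
    by rewrite /Y -sumrN; apply: eq_bigr => c _; rewrite adjmxN mulmxN.
  by rewrite adjmxN opprD.
by apply: psd_sum => c _; exact: psd_mulmx_adj.
Qed.

Lemma choi_hsadj_herm m n (psi : 'M[C]_m -> 'M[C]_n) : hpmap psi ->
  adjmx (choi (hsadj psi)) = choi (hsadj psi).
Proof. by move=> h; rewrite choi_hsadj_hp // adjmx_tr h. Qed.

(* Since the Choi matrix has vanishing marginal, adding [s (x) 1] to the test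
   operator costs nothing and makes it positive. *)
Lemma rtr_idtens_witness r m n N (psi : 'M[C]_m -> 'M[C]_n) (U : 'M[C]_(r * n))
    (A B : 'M[C]_(r * m, N)) :
  linmap psi -> hpmap psi -> (forall X, \tr (psi X) = 0) -> unitary U ->
  exists W s, [/\ psd s, rtr s = (nsq A + nsq B) / 2, psd W, psd (s *t 1%:M - W)
    & rtr (U *m idtens psi (A *m adjmx B)) = 2 * rtr (W *m choi (hsadj psi))].
Proof.
move=> l h t0 uU.
pose K c : 'M[C]_(m * n, r * n) := unvec A c *t 1%:M.
pose L c : 'M[C]_(m * n, r * n) := unvec B c *t 1%:M.
have [] := psd_sandwichDB K L (unitary_tr uU).
set Y := \sum_c K c *m _ *m _; set S2 := \sum_c (_ + _) => pp pm.
pose s2 : 'M[C]_m := \sum_c (unvec A c *m adjmx (unvec A c) + unvec B c *m adjmx (unvec B c)).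
have S2E : S2 = s2 *t 1%:M.
  rewrite tens1_sum; apply: eq_bigr => c _.
  by rewrite tens1D !tens1M /K /L !adjmx_tens1.
have ps2 : psd s2 by apply: psd_sum => c _; apply: psdD; exact: psd_mulmx_adj.
(* With these scalars [s (x) 1 - W] is a quarter of [S2 - (Y + adjmx Y)]. Against the Choi matrix
   [S2] gives zero, while [Y] and [adjmx Y] give the same real part, so [W] collects half the value
   of [Y]. *)
exists ((4^-1)%:C%C *: (S2 + (Y + adjmx Y))), ((2^-1)%:C%C *: s2); split.
- by apply: psdZ => //; rewrite invr_ge0 ler0n.
- rewrite rtrZ /s2 rtr_sum (eq_bigr _ (fun c _ => rtrD _ _)) big_split /=.
  by rewrite -!/(nsq _) !nsq_unvec mulrC.
- by apply: psdZ => //; rewrite invr_ge0 ler0n.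
- have -> : (2^-1)%:C%C *: s2 *t 1%:M - (4^-1)%:C%C *: (S2 + (Y + adjmx Y)) =
    (4^-1)%:C%C *: (S2 - (Y + adjmx Y)).
    rewrite tens1Z -S2E scalerBr scalerDr opprD addrA; congr (_ - _).
    by rewrite -scalerBl -rmorphB; congr (_%:C%C *: _); field.
  by apply: psdZ => //; rewrite invr_ge0 ler0n.
rewrite [in LHS]/rtr tr_idtens_mul_adj // -/Y -/(rtr _) -scalemxAl rtrZ !mulmxDl !rtrD.
have -> : rtr (adjmx Y *m choi (hsadj psi)) = rtr (Y *m choi (hsadj psi)).
  by rewrite -[LHS]rtr_adj adjmxM adjmxK choi_hsadj_herm // rtrC.
have -> : rtr (S2 *m choi (hsadj psi)) = 0.
  rewrite S2E /rtr tr_tens1 (@ptr2_choi_hsadj _ _ _ _ 0) => [|X]; last by rewrite mul0r.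
  by rewrite conjc0 scale0r mulmx0 mxtrace0.
by field.
Qed.

Lemma density_scalar m : (0 < m)%N -> density ((m%:R^-1)%:C%C *: (1%:M : 'M[C]_m)).
Proof.
move=> m0; split; first by apply: psdZ; [rewrite invr_ge0 ler0n|exact: psd1].
rewrite mxtraceZ mxtrace1 -(rmorph_nat (real_complex R)) -rmorphM.
by rewrite mulVf ?rmorph1 // pnatr_eq0 -lt0n.
Qed.

Lemma density_rtr m (s : 'M[C]_m) : density s -> rtr s = 1.
Proof. by move=> [_ h]; rewrite /rtr h. Qed.

Lemma rtr_density m (s : 'M[C]_m) : psd s -> rtr s = 1 -> density s.
Proof. by move=> p h; split=> //; rewrite psd_trE // h rmorph1. Qed.

Lemma density_majorant m (s : 'M[C]_m) (t : R) : (0 < m)%N -> psd s ->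
  0 < t -> rtr s <= t ->
  exists2 s', density s' & psd (t%:C%C *: s' - s).
Proof.
move=> m0 ps tp st.
have tE : t%:C%C * (t^-1)%:C%C = 1 :> C by rewrite -rmorphM mulfV ?rmorph1 // gt_eqF.
pose c := (t - rtr s) / m%:R.
have pc : psd (c%:C%C *: (1%:M : 'M[C]_m)).
  by apply: psdZ; [rewrite divr_ge0 ?subr_ge0 ?ler0n|exact: psd1].
exists ((t^-1)%:C%C *: (s + c%:C%C *: 1%:M)).
  apply: rtr_density.
    by apply: psdZ; [rewrite invr_ge0 ltW|exact: psdD].
  rewrite rtrZ rtrD rtrZ rtr1 /c divfK ?pnatr_eq0 -?lt0n // addrC subrK.
  by rewrite mulVf // gt_eqF.
by rewrite scalerA tE scale1r addrAC subrr add0r.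
Qed.

Definition test_bound m n (psi : 'M[C]_m -> 'M[C]_n) (d : R) : Prop :=
  forall W s, density s -> psd W -> psd (s *t 1%:M - W) ->
    rtr (W *m choi (hsadj psi)) <= d.

Lemma tnorm_idtens_le r m n (psi : 'M[C]_m -> 'M[C]_n) (d : R) (X : 'M[C]_(r * m)) :
  (0 < m)%N -> linmap psi -> hpmap psi -> (forall X, \tr (psi X) = 0) ->
  0 <= d -> test_bound psi d -> tnorm X <= 1 -> tnorm (idtens psi X) <= 2 * d.
Proof.
move=> m0 l h t0 d0 hd X1; apply: tnorm_le => U uU; apply: le_addgt0 => e e0.
(* The factorisation is optimal only up to [e'], so [s] has trace up to [1 + e'] and the test must
   be rescaled; the resulting loss [2 * e' * d] stays below [e]. *)
have e'0 : 0 < e / (2 * d + 1) by rewrite divr_gt0 // ltr_wpDl // mulr_ge0.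
set e' := e / _ in e'0.
have [A [B [XAB hAB]]] := tnorm_factor X e'0; rewrite XAB.
have [W [s [ps st pW sW ->]]] := rtr_idtens_witness A B l h t0 uU.
have t0' : 0 < 1 + e' by lra.
have st' : rtr s <= 1 + e' by rewrite st; lra.
have [s' ds' ss'] := density_majorant m0 ps t0' st'.
pose t' := (1 + e')^-1; have t'0 : 0 <= t' by rewrite invr_ge0 ltW.
have tt : t' * (1 + e') = 1 by rewrite mulVf // gt_eqF.
have := hd (t'%:C%C *: W) s' ds' (psdZ t'0 pW).
rewrite -scalemxAl rtrZ => h1.
have {h1} : t' * rtr (W *m choi (hsadj psi)) <= d.
  apply: h1.
  have -> : s' *t 1%:M - t'%:C%C *: W =
    t'%:C%C *: (((1 + e')%:C%C *: s' - s) *t 1%:M + (s *t 1%:M - W)).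
    rewrite addrA -tens1D subrK scalerBr tens1Z scalerA -rmorphM tt.
    by rewrite rmorph1 scale1r.
  exact: (psdZ t'0 (psdD (psd_tens1 n ss') sW)).
set x := rtr _ => hx.
have : x <= (1 + e') * d.
  have -> : x = (1 + e') * (t' * x) by rewrite mulrA [_ * t']mulrC tt mul1r.
  by rewrite ler_pM2l.
have : e' * (2 * d + 1) = e by rewrite /e' divfK // gt_eqF // ltr_wpDl // mulr_ge0.
by nra.
Qed.

Section DiffChannels.
Variables (m n : nat) (phi1 phi2 : 'M[C]_m -> 'M[C]_n).
Hypotheses (m0 : (0 < m)%N) (c1 : channel phi1) (c2 : channel phi2).
Let psi X := phi1 X - phi2 X.

Lemma linmap_diff : linmap psi.
Proof.
case: c1 c2 => [l1 _ _] [l2 _ _] a X Y; rewrite /psi l1 l2 scalerBr opprD.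
by rewrite addrACA.
Qed.

Lemma idtens_diff r (X : 'M[C]_(r * m)) : idtens psi X = idtens phi1 X - idtens phi2 X.
Proof. by apply: tens_matrixP => p i q j; rewrite !mxE. Qed.

Lemma hpmap_diff : hpmap psi.
Proof.
rewrite /hpmap /Jmx idtens_diff adjmxD adjmxN.
by rewrite -!/(Jmx _) (channel_hp c1) (channel_hp c2).
Qed.

Lemma tr_diff X : \tr (psi X) = 0.
Proof. by case: c1 c2 => [_ _ t1] [_ _ t2]; rewrite linearB /= t1 t2 subrr. Qed.

Lemma choi_hsadj_diff :
  choi (hsadj psi) = choi (hsadj phi1) - choi (hsadj phi2).
Proof.
by rewrite !choi_hsadj /Jmx idtens_diff adjmxD adjmxN linearB.
Qed.

Lemma rtr_choi_channel_le (g : 'M[C]_m -> 'M[C]_n) W s : channel g ->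
  psd (s *t 1%:M - W) -> rtr (W *m choi (hsadj g)) <= rtr s.
Proof.
move=> cg sW; have := rtr_le (psd_choi_hsadj cg) sW.
by rewrite /rtr tr_tens1_choi //; case: cg.
Qed.

(** A crude bound that makes the set under the supremum in [diamond] bounded, on which [diamond_ge]
    rests. *)
Lemma test_bound_diff : test_bound psi 1.
Proof.
move=> W s ds pW sW; rewrite choi_hsadj_diff mulmxBr rtrB.
rewrite -(density_rtr ds); apply: le_trans (rtr_choi_channel_le c1 sW).
by rewrite lerBlDr lerDl; exact: psd_rtr_ge0 pW (psd_choi_hsadj c2).
Qed.

Lemma diamond_le d : 0 <= d -> test_bound psi d -> diamond psi <= 2 * d.
Proof.
move=> d0 hd.
apply: (@sup_image_le R _ [set X : 'M[C]_(m * m) | tnorm X <= 1] _ _ 0).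
  by apply: tnorm_le => U _; rewrite mulmx0 rtr0 ler01.
move=> X; apply: tnorm_idtens_le => //;
  [exact: linmap_diff|exact: hpmap_diff|exact: tr_diff].
Qed.

Lemma diamond_ge (X : 'M[C]_(m * m)) : tnorm X <= 1 -> tnorm (idtens psi X) <= diamond psi.
Proof.
apply: (@sup_image_ge R _ [set X : 'M[C]_(m * m) | tnorm X <= 1] _ (2 * 1)).
move=> Y; apply: tnorm_idtens_le => //;
  [exact: linmap_diff|exact: hpmap_diff|exact: tr_diff|exact: test_bound_diff].
Qed.

Lemma diamond_ge0 : 0 <= diamond psi.
Proof.
apply: le_trans (tnorm_ge0 _) (@diamond_ge 0 _).
by apply: tnorm_le => U _; rewrite mulmx0 rtr0 ler01.
Qed.

(** The bound on [W] is turned into a pure input. For [u] the normalised vector of [k], the output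
    of [idtens psi] is, up to transposition, the Choi matrix conjugated by [k], and [W] is an
    operator [P] between 0 and 1 seen through that conjugation. Then [2 P - 1] is a contraction
    whose constant part pairs to zero. Invertibility of [k] recovers [P] from [W]. *)
Lemma rtr_choi_le_diamond (k : 'M[C]_m) (W : 'M[C]_(m * n)) : k \in unitmx ->
  psd W -> psd ((k *m adjmx k) *t 1%:M - W) ->
  2 * rtr (W *m choi (hsadj psi)) <= nsq k * diamond psi.
Proof.
move=> uk pW kW.
have c0 : 0 < nsq k.
  rewrite lt_neqAle nsq_ge0 andbT eq_sym; apply/negP => /eqP k0.
  have k00 : k = 0 by apply: nsq_eq0; rewrite k0.
  move: uk; rewrite k00; case: (m) m0 => // m' _.
  by rewrite unitmxE det0 unitr0.
pose c := Num.sqrt (nsq k)^-1.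
have cc : c ^+ 2 * nsq k = 1.
  by rewrite sqr_sqrtr ?invr_ge0 ?(ltW c0) // mulVf // gt_eqF.
pose u : 'cV[C]_(m * m) := \col_x (c%:C%C * k (mxtens_unindex x).2 (mxtens_unindex x).1).
have uE : unvec u 0 = c%:C%C *: k.
  by apply/matrixP=> a p; rewrite !mxE !mxtens_indexK.
have nu : nsq u = 1 by rewrite -nsq_unvec big_ord1 uE nsqZ.
have tu : tnorm (u *m adjmx u) <= 1.
  by apply: le_trans (tnorm_mul_adj _ _) _; rewrite nu; lra.
pose ki : 'M[C]_(m * n) := invmx k *t 1%:M.
pose P := ki *m W *m adjmx ki.
have kki : (k *t 1%:M) *m ki = 1%:M by rewrite /ki -tens1M mulmxV // tens11.
have kik : ki *m (k *t 1%:M) = 1%:M by rewrite /ki -tens1M mulVmx // tens11.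
have pP : psd P by exact: psd_conj.
have p1P : psd (1%:M - P).
  have -> : 1%:M - P = ki *m ((k *m adjmx k) *t 1%:M - W) *m adjmx ki.
    rewrite mulmxBr mulmxBl; congr (_ - _).
    rewrite tens1M -adjmx_tens1 mulmxA kik mul1mx -adjmxM.
    by rewrite kik adjmx1.
  exact: psd_conj.
pose H := 2%:C%C *: P - 1%:M.
have herm : adjmx (idtens psi (u *m adjmx u)) = idtens psi (u *m adjmx u).
  rewrite idtens_diff adjmxD adjmxN.
  have [_ cp1 _] := c1; have [_ cp2 _] := c2.
  by have [-> _] := cp1 m _ (psd_mulmx_adj u); have [-> _] := cp2 m _ (psd_mulmx_adj u).
have pm : psd (1%:M - H^T).
  have -> : 1%:M - H^T = 2%:C%C *: (1%:M - P)^T.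
    rewrite -{1}(trmx1 _ (m * n)) -linearB -linearZ /=; congr _^T.
    rewrite /H opprB addrA scalerBr; congr (_ - _).
    by rewrite -mulr2n -scaler_nat rmorph_nat.
  by apply: psdZ; [rewrite ler0n|exact: psd_tr].
have pp : psd (1%:M + H^T).
  have -> : 1%:M + H^T = 2%:C%C *: P^T.
    rewrite -{1}(trmx1 _ (m * n)) -linearD -linearZ /=; congr _^T.
    by rewrite /H addrC subrK.
  by apply: psdZ; [rewrite ler0n|exact: psd_tr].
have := le_trans (rtr_contraction_le herm pm pp) (diamond_ge tu).
rewrite {1}/rtr tr_idtens_mul_adj; [|exact: linmap_diff|exact: hpmap_diff].
rewrite big_ord1 uE trmxK -/(rtr _) tens1Z adjmxZ -!scalemxAl -scalemxAr.
rewrite -scalemxAl !rtrZ /H mulmxBr mulmxBl -scalemxAr -scalemxAl mulmx1.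
have -> : (k *t 1%:M) *m P *m adjmx (k *t 1%:M) = W.
  rewrite /P !mulmxA kki mul1mx -mulmxA -adjmxM kki adjmx1.
  by rewrite mulmx1.
rewrite mulmxBl rtrB -scalemxAl rtrZ.
have -> : rtr (k *t 1%:M *m adjmx (k *t 1%:M) *m choi (hsadj psi)) = 0.
  rewrite adjmx_tens1 -tens1M /rtr tr_tens1 (@ptr2_choi_hsadj _ _ _ _ 0) => [|X].
    by rewrite conjc0 scale0r mulmx0 mxtrace0.
  by rewrite mul0r; exact: tr_diff.
rewrite subr0 mulrA -expr2; set x := 2 * _ => hx.
have -> : x = nsq k * (c ^+ 2 * x) by rewrite mulrA [nsq k * _]mulrC cc mul1r.
by rewrite ler_pM2l.
Qed.

End DiffChannels.
End Diamond.

(** * Duality for the norm [cbnorm] *)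
Section CbDual.
Context {R : realType}.
Local Notation C := (R[i]).
Local Open Scope classical_set_scope.
Implicit Types (m n r : nat).

Lemma qf_rtr n (A : 'M[C]_n) (v : 'cV[C]_n) :
  complex.Re (qf A v v) = rtr (v *m adjmx v *m A).
Proof.
rewrite rtrC mulmxA rtrC mulmxA /rtr /mxtrace big_ord1.
by [].
Qed.

Lemma psd_density_test n (M : 'M[C]_n) : adjmx M = M ->
  (forall Z, density Z -> 0 <= rtr (Z *m M)) -> psd M.
Proof.
move=> hM h; apply: psd_qf => v.
have im : complex.Im (qf M v v) = 0.
  have := conjc_qf M v v; rewrite hM; case: (qf M v v) => a b /= [/eqP].
  by rewrite -subr_eq0 -opprD oppr_eq0 -mulr2n mulrn_eq0 => /eqP.
rewrite lecE im eqxx /= qf_rtr.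
have [v0|v0] := leP (nsq v) 0.
  by rewrite (nsq_eq0 v0) !mul0mx rtr0.
have dZ : density (((nsq v)^-1)%:C%C *: (v *m adjmx v)).
  apply: rtr_density.
    by apply: psdZ; [rewrite invr_ge0 ltW|exact: psd_mulmx_adj].
  by rewrite rtrZ -/(nsq v) mulVf // gt_eqF.
by have := h _ dZ; rewrite -scalemxAl rtrZ pmulr_rge0 // invr_gt0.
Qed.

Lemma density_mix n (A B : 'M[C]_n) (t : R) : 0 <= t <= 1 -> density A -> density B ->
  density ((1 - t)%:C%C *: A + t%:C%C *: B).
Proof.
move=> /andP[t0 t1] dA dB; apply: rtr_density.
  by apply: psdD; apply: psdZ; rewrite ?subr_ge0 //; [case: dA|case: dB].
by rewrite rtrD !rtrZ !density_rtr // !mulr1 subrK.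
Qed.

Lemma psd_max_eigen m (z : 'M[C]_m) : (0 < m)%N -> psd z ->
  exists s c, [/\ density s, rtr (s *m z) = c & psd (c%:C%C *: 1%:M - z)].
Proof.
move=> m0 pz; have [V [d [uV zE d0]]] := psd_spectral pz.
have uV' := mulmx1C uV.
pose j0 : 'I_m := Ordinal m0.
pose j := [arg max_(i > j0) d 0 i]%O.
have jmax i : d 0 i <= d 0 j.
  by rewrite /j; case: arg_maxP => // k _ h; exact: h.
pose v := col j (adjmx V).
exists (v *m adjmx v), (d 0 j); split.
- apply: rtr_density; first exact: psd_mulmx_adj.
  rewrite rtrC /rtr /mxtrace big_ord1.
  have -> : adjmx v *m v = delta_mx 0 j *m (V *m adjmx V) *m delta_mx j 0.
    by rewrite /v colE adjmxM adjmxK adjmx_delta !mulmxA.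
  by rewrite uV mulmx1 mul_delta_mx mxE.
- by rewrite -qf_rtr (unitary_diagE uV zE).
have -> : (d 0 j)%:C%C *: 1%:M - z =
    adjmx V *m dgmx (\row_i (d 0 j - d 0 i)) *m adjmx (adjmx V).
  rewrite adjmxK zE.
  have -> : dgmx (\row_i (d 0 j - d 0 i)) = (d 0 j)%:C%C *: 1%:M - dgmx d.
    apply/matrixP=> a b; rewrite !mxE; case: eqP => _; rewrite ?mulr1n ?mulr0n.
      by rewrite rmorphB mulr1.
    by rewrite mulr0 subr0.
  by rewrite mulmxBr mulmxBl -scalemxAr -scalemxAl mulmx1 uV'.
by apply: psd_conj; apply: psd_dgmx => i; rewrite mxE subr_ge0.
Qed.

Lemma rtr_tens1 m n (s : 'M[C]_m) : rtr (s *t (1%:M : 'M[C]_n)) = n%:R * rtr s.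
Proof.
rewrite -[_ *t _]mulmx1 /rtr tr_tens1 -tens11 ptr2_tens mxtrace1 -scalemxAr mulmx1.
by rewrite mxtraceZ -(rmorph_nat (real_complex R)) ReZ.
Qed.

Lemma ptr2Z m n a (Z : 'M[C]_(m * n)) : ptr2 (a *: Z) = a *: ptr2 Z.
Proof.
apply/matrixP=> p q; rewrite !mxE -mxtraceZ; congr (\tr _).
by apply/matrixP=> i j; rewrite !mxE.
Qed.

Lemma rtr_ptr2 m n (Z : 'M[C]_(m * n)) : rtr (ptr2 Z) = rtr Z.
Proof. by have := tr_tens1 1%:M Z; rewrite tens11 !mul1mx /rtr => ->. Qed.

(** For fixed [Z] the best [s] projects on a top eigenvector of the marginal of [Z]. Division by the
    eigenvalue [c] brings the marginal below 1, so [Z / c] lies below the Choi matrix of a channel,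
    against which [rho] gives at most [lam]. *)
Lemma cb_dual_pointwise m n (rho Z : 'M[C]_(m * n)) (lam : R) :
  (0 < m)%N -> (0 < n)%N -> psd rho ->
  (forall g : 'M[C]_m -> 'M[C]_n, channel g -> rtr (rho *m choi (hsadj g)) <= lam) ->
  density Z ->
  exists2 s, density s & rtr (Z *m rho) <= lam * rtr (Z *m (s *t 1%:M)).
Proof.
move=> m0 n0 prho hlam dZ; have [pZ _] := dZ.
have [s [c [ds sc cz]]] := psd_max_eigen m0 (psd_ptr2 pZ).
exists s => //.
have -> : rtr (Z *m (s *t 1%:M)) = c by rewrite rtrC /rtr tr_tens1.
have c0 : 0 < c.
  rewrite ltNge; apply/negP => c0; have := rtr_psd cz.
  rewrite rtrB rtrZ rtr1 rtr_ptr2 (density_rtr dZ) subr_ge0.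
  by have := ler0n R m; nra.
have pc : psd ((c^-1)%:C%C *: Z) by apply: psdZ; rewrite ?invr_ge0 ?(ltW c0).
have [|g cg gZ] := channel_ge n0 pc.
  rewrite ptr2Z.
  have -> : 1%:M - (c^-1)%:C%C *: ptr2 Z = (c^-1)%:C%C *: (c%:C%C *: 1%:M - ptr2 Z).
    by rewrite scalerBr scalerA -rmorphM mulVf ?gt_eqF // rmorph1 scale1r.
  by apply: psdZ; rewrite ?invr_ge0 ?(ltW c0).
have := rtr_le prho gZ; rewrite -scalemxAl rtrZ => h1.
have := le_trans h1 _; rewrite rtrC => /(_ _ (hlam g cg)).
by rewrite mulrC ler_pdivrMr.
Qed.

Lemma cb_dual m n (rho : 'M[C]_(m * n)) (lam : R) :
  (0 < m)%N -> (0 < n)%N -> psd rho -> 0 <= lam ->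
  (forall g : 'M[C]_m -> 'M[C]_n, channel g -> rtr (rho *m choi (hsadj g)) <= lam) ->
  forall e, 0 < e -> exists2 s, density s &
    psd ((lam%:C%C *: s + e%:C%C *: 1%:M) *t 1%:M - rho).
Proof.
move=> m0 n0 prho lam0 hlam e e0.
(* The payoff is [lam Tr[Z (s (x) 1)] - Tr[Z rho]]. Being at least [- e] against all states [Z]
   amounts to positivity of the shifted difference. *)
pose P : set 'M[C]_(m * n) := [set p | exists2 s : 'M[C]_m, density s & p = s *t 1%:M].
pose S : set ('M[C]_(m * n) * R) :=
  [set q | exists2 Z, density Z & q = (lam%:C%C *: Z, - rtr (Z *m rho))].
have mn0 : (0 < m * n)%N by rewrite muln_gt0 m0.
have Zrho Z : density Z -> 0 <= rtr (Z *m rho) <= rtr rho.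
  move=> dZ; have [pZ _] := dZ; rewrite psd_rtr_ge0 //=.
  by have := rtr_le prho (psd_le_rtr pZ); rewrite (density_rtr dZ) scale1r mul1mx.
have [|||||p [s ds ->] hs] := @minimax R (m * n) P S (n%:R ^+ 2) (lam ^+ 2 + rtr rho)
  _ _ (ex_intro2 _ _ _ (density_scalar m0) erefl)
  (ex_intro2 _ _ _ (density_scalar mn0) erefl) _ _ _ _ _ e e0.
- move=> _ _ [s ds ->] [s' ds' ->].
  exists ((1 - 2^-1)%:C%C *: s + (2^-1)%:C%C *: s').
    by apply: density_mix => //; apply/andP; split; lra.
  rewrite tens1D !tens1Z scalerDr; congr (_%:C%C *: _ + _); lra.
- move=> _ [s [ps ts] ->]; apply: le_trans (psd_nsq (psd_tens1 n ps)) _.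
  by rewrite rtr_tens1 (@density_rtr _ _ s) ?mulr1.
- move=> t _ _ t01 [Z dZ ->] [Z' dZ' ->] /=.
  exists ((1 - t)%:C%C *: Z + t%:C%C *: Z'); first exact: density_mix.
  rewrite scalerDr !scalerA ![lam%:C%C * _]mulrC mulmxDl -!scalemxAl rtrD !rtrZ.
  by rewrite opprD !mulrN.
- move=> _ [Z dZ ->] /=; have /andP[r0 r1] := Zrho _ dZ.
  have rr := rtr_psd prho.
  split; last by rewrite normrN ger0_norm // (le_trans r1) // lerDr sqr_ge0.
  rewrite nsqZ; have [pZ _] := dZ; have := psd_nsq pZ; rewrite (density_rtr dZ) expr1n => h.
  by apply: (le_trans (ler_wpM2l (sqr_ge0 lam) h)); rewrite mulr1 lerDl.
- move=> _ x [Z dZ ->] x0 /=.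
  have [s ds hs] := cb_dual_pointwise m0 n0 prho hlam dZ.
  exists (s *t 1%:M); first by exists s.
  by rewrite -scalemxAl rtrZ; lra.
exists s => //; have [ps _] := ds.
have hrho : adjmx rho = rho by case: prho.
apply: psd_density_test.
  rewrite adjmxD adjmxN hrho; congr (_ - _).
  rewrite adjmx_tens1 adjmxD !adjmxZ adjmx1.
  by case: ps => ->.
move=> Z dZ; have := hs _ (ex_intro2 _ _ Z dZ erefl) => /=.
rewrite -scalemxAl rtrZ tens1D !tens1Z tens11 mulmxBr mulmxDr -!scalemxAr mulmx1.
by rewrite rtrB rtrD !rtrZ (density_rtr dZ); lra.
Qed.

(** The shift makes the root invertible, as [rtr_choi_le_diamond] requires. *)
Lemma psd_shift_factor m (A : 'M[C]_m) (e : R) : psd A -> 0 < e ->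
  exists2 k : 'M[C]_m, k \in unitmx & k *m adjmx k = A + e%:C%C *: 1%:M.
Proof.
move=> /psd_spectral[V [d [uV -> d0]]] e0; have uV' := mulmx1C uV.
have dp j : 0 < d 0 j + e by rewrite ltr_wpDl.
exists (adjmx V *m dgmx (\row_j Num.sqrt (d 0 j + e))).
  rewrite unitmx_mul (unitmx_adj (unitary_unitmx uV)) /=.
  rewrite unitmxE det_diag unitfE; apply/prodf_neq0 => j _; rewrite !mxE.
  by rewrite -(rmorph0 (real_complex R)) (inj_eq (@complexI R)) gt_eqF // sqrtr_gt0.
rewrite adjmxM adjmxK adjmx_dgmx mulmxA -(mulmxA (adjmx V)) dgmxM.
have -> : dgmx (\row_j ((\row_j Num.sqrt (d 0 j + e)) 0 j * (\row_j Num.sqrt (d 0 j + e)) 0 j))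
   = dgmx d + e%:C%C *: 1%:M.
  apply/matrixP=> a b; rewrite !mxE; case: eqP => _; rewrite ?mulr1n ?mulr0n.
    by rewrite -expr2 sqr_sqrtr ?(ltW (dp _)) // rmorphD mulr1.
  by rewrite mulr0 addr0.
by rewrite mulmxDr mulmxDl -scalemxAr -scalemxAl mulmx1 uV'.
Qed.

End CbDual.

(** * The test criterion *)
Section CbNorm.
Context {R : realType}.
Local Notation C := (R[i]).
Local Open Scope classical_set_scope.
Implicit Types (m n r : nat).

Lemma rtr_choi_psd_le r n (rho : 'M[C]_(r * n)) (g : 'M[C]_r -> 'M[C]_n) :
  psd rho -> channel g -> rtr (rho *m choi (hsadj g)) <= rtr rho * r%:R.
Proof.
move=> prho cg; have := psd_le_rtr prho; rewrite -tens11 -tens1Z.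
by move=> /(rtr_choi_channel_le cg); rewrite rtrZ rtr1.
Qed.

Lemma cbnorm_ge r n (rho : 'M[C]_(r * n)) (g : 'M[C]_r -> 'M[C]_n) :
  psd rho -> channel g -> rtr (rho *m choi (hsadj g)) <= cbnorm rho.
Proof.
move=> prho cg; apply: (@sup_image_ge R _ [set a : 'M[C]_r -> 'M[C]_n | channel a]
  (fun a => rtr (rho *m choi (hsadj a))) (rtr rho * r%:R)) => // a ca.
exact: rtr_choi_psd_le.
Qed.

Lemma cbnorm_le r n (rho : 'M[C]_(r * n)) (c : R) : (0 < n)%N ->
  (forall g : 'M[C]_r -> 'M[C]_n, channel g -> rtr (rho *m choi (hsadj g)) <= c) ->
  cbnorm rho <= c.
Proof.
move=> n0 h; have [g0 cg0] := @channel_exists R r n n0.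
apply: (@sup_image_le R _ [set a : 'M[C]_r -> 'M[C]_n | channel a]
  (fun a => rtr (rho *m choi (hsadj a))) _ g0) => // a ca; exact: h.
Qed.

Lemma cbnorm_ge0 r n (rho : 'M[C]_(r * n)) : (0 < n)%N -> psd rho -> 0 <= cbnorm rho.
Proof.
move=> n0 prho; have [g cg] := @channel_exists R r n n0.
apply: le_trans (cbnorm_ge prho cg); apply: psd_rtr_ge0 => //; exact: psd_choi_hsadj.
Qed.

(** The quantities attached to the two channels in (ii), and likewise in (iii), all take this form,
    by [cbnorm_mtrans] and [sup_psucc]. *)
Definition comp_sup r m n (Phi : 'M[C]_m -> 'M[C]_n) (rho : 'M[C]_(r * n)) : R :=
  sup [set rtr (rho *m choi (hsadj (Phi \o a)))
      | a in [set a : 'M[C]_r -> 'M[C]_m | channel a]].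

Lemma cbnorm_mtrans r m n (Phi : 'M[C]_m -> 'M[C]_n) (rho : 'M[C]_(r * n)) :
  channel Phi -> cbnorm (idtens (mtrans Phi) rho) = comp_sup Phi rho.
Proof.
move=> cP; congr sup; apply: eq_imagel => a ca.
rewrite pairing_idtens_mtrans //; [exact: channel_lin|exact: channel_hp..|].
by apply: channel_hp; exact: channel_comp.
Qed.

Lemma comp_sup_ge r m n (Phi : 'M[C]_m -> 'M[C]_n) (rho : 'M[C]_(r * n))
    (a : 'M[C]_r -> 'M[C]_m) : channel Phi -> psd rho -> channel a ->
  rtr (rho *m choi (hsadj (Phi \o a))) <= comp_sup Phi rho.
Proof.
move=> cP prho ca; apply: (@sup_image_ge R _ [set a : 'M[C]_r -> 'M[C]_m | channel a]
  (fun a => rtr (rho *m choi (hsadj (Phi \o a)))) (rtr rho * r%:R)) => // b cb.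
by apply: rtr_choi_psd_le => //; exact: channel_comp.
Qed.

Lemma comp_sup_le r m n (Phi : 'M[C]_m -> 'M[C]_n) (rho : 'M[C]_(r * n)) (c : R) :
  (0 < m)%N -> (forall a : 'M[C]_r -> 'M[C]_m, channel a ->
    rtr (rho *m choi (hsadj (Phi \o a))) <= c) -> comp_sup Phi rho <= c.
Proof.
move=> m0 h; have [g0 cg0] := @channel_exists R r m m0.
apply: (@sup_image_le R _ [set a : 'M[C]_r -> 'M[C]_m | channel a]
  (fun a => rtr (rho *m choi (hsadj (Phi \o a)))) _ g0) => // a ca; exact: h.
Qed.

Lemma comp_sup_adherent r m n (Phi : 'M[C]_m -> 'M[C]_n) (rho : 'M[C]_(r * n)) (e : R) :
  (0 < m)%N -> channel Phi -> psd rho -> 0 < e ->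
  exists2 a : 'M[C]_r -> 'M[C]_m, channel a &
    comp_sup Phi rho - e < rtr (rho *m choi (hsadj (Phi \o a))).
Proof.
move=> m0 cP prho e0; have [g0 cg0] := @channel_exists R r m m0.
apply: (@sup_image_adherent R _ [set a : 'M[C]_r -> 'M[C]_m | channel a]
  (fun a => rtr (rho *m choi (hsadj (Phi \o a)))) (rtr rho * r%:R) e g0) => // b cb.
by apply: rtr_choi_psd_le => //; exact: channel_comp.
Qed.

Lemma rtr_tens1B_choi m n (s : 'M[C]_m) (W : 'M[C]_(m * n)) (g : 'M[C]_m -> 'M[C]_n) :
  channel g ->
  rtr ((s *t 1%:M - W) *m choi (hsadj g)) = rtr s - rtr (W *m choi (hsadj g)).
Proof.
move=> [_ _ tg]; rewrite mulmxBl rtrB; congr (_ - _).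
by rewrite /rtr tr_tens1_choi.
Qed.

End CbNorm.

(** * Elementary real inequalities *)

Section Slack.
Context {R : realType}.

Lemma slack_le (a b h y : R) : b <= a + h + y -> - y <= a + (h - b).
Proof. lra. Qed.

Lemma slack_sub_le (a b u v w h e : R) : a = u - v -> b = u - w ->
  - e <= a + (h - b) -> v - w <= h + e.
Proof. by move=> -> ->; lra. Qed.

Lemma slack_sup_le (a b S1 S2 c d e : R) :
  b <= S2 -> S2 <= S1 + c -> c <= d -> S1 - e < a -> b <= a + d + e.
Proof. lra. Qed.

Lemma norm_sub_le (h y z : R) : 0 <= h -> 0 <= y -> y <= 1 -> 0 <= z ->
  `|h - y| <= z + (h + 1).
Proof. by move=> *; rewrite ler_norml; apply/andP; split; lra. Qed.

End Slack.

(** * From the distance to operator inequalities, and back from single tests *)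

Section DeltaPre.
Context {R : realType}.
Local Notation C := (R[i]).
Local Open Scope classical_set_scope.
Variables (a0 a0' a1 : nat) (Phi1 : 'M[C]_a0 -> 'M[C]_a1) (Phi2 : 'M[C]_a0' -> 'M[C]_a1).
Variable eps : R.
Hypotheses (a0_gt0 : (0 < a0)%N) (a0'_gt0 : (0 < a0')%N) (a1_gt0 : (0 < a1)%N).
Hypotheses (cPhi1 : channel Phi1) (cPhi2 : channel Phi2) (eps_ge0 : 0 <= eps).

Let diff (L : 'M[C]_a0' -> 'M[C]_a0) X := Phi1 (L X) - Phi2 X.

Lemma has_inf_delta_pre :
  has_inf [set diamond (diff L) | L in [set L : 'M[C]_a0' -> 'M[C]_a0 | channel L]].
Proof.
split.
  by have [g cg] := @channel_exists R a0' a0 a0_gt0; exists (diamond (diff g)), g.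
exists 0 => _ [L cL <-].
exact: (diamond_ge0 a0'_gt0 (channel_comp cPhi1 cL) cPhi2).
Qed.

Lemma rtr_link_pull r (rho : 'M[C]_(r * a1)) (al : 'M[C]_r -> 'M[C]_a0')
    (g : 'M[C]_a0' -> 'M[C]_a1) : channel al -> channel g ->
  rtr (link (swapmx (Jmx al)) rho *m choi (hsadj g)) =
  rtr (rho *m choi (hsadj (g \o al))).
Proof.
move=> ca cg; have := @pairing_pull R r a0' a1 g al rho (channel_lin cg) (channel_hp cg)
  (channel_hp (channel_comp cg ca)).
by rewrite /rtr /pairing => ->.
Qed.

(** A nearly optimal [L] answers the strategy [al] for [Phi2] by [L \o al] for [Phi1]. The loss is
    estimated after [al] has been absorbed into [rho], where [cb_dual] provides a state on the input
    space of [Phi2]. *)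
Lemma delta_pre_comp_sup r (rho : 'M[C]_(r * a1)) : delta_pre Phi1 Phi2 <= eps ->
  psd rho -> comp_sup Phi2 rho <= comp_sup Phi1 rho + eps / 2 * cbnorm rho.
Proof.
move=> hd prho; apply: comp_sup_le => // al cal; apply: le_addgt0 => x x0.
have lam0 := cbnorm_ge0 a1_gt0 prho; set lam := cbnorm rho in lam0 *.
pose e := x / (lam + 1).
have e0 : 0 < e by rewrite divr_gt0 // ltr_wpDl.
have [_ [L cL <-] hL] := inf_adherent e0 has_inf_delta_pre.
rewrite -/(delta_pre Phi1 Phi2) in hL.
have cPL := channel_comp cPhi1 cL.
pose rho2 := link (swapmx (Jmx al)) rho.
have prho2 : psd rho2.
  by apply: psd_link => //; apply/psd_swapmx/psd_Jmx; case: cal.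
(* The two error terms are [lam * e] and [e2 * M]; the tolerances keep each below [x], and the final
   halving leaves [x]. *)
pose M : R := a0'%:R * (eps + e).
have M0 : 0 <= M by rewrite mulr_ge0 ?ler0n // addr_ge0 // ltW.
pose e2 := x / (M + 1).
have e20 : 0 < e2 by rewrite divr_gt0 // ltr_wpDl.
(* The channels [g \o al] are among those in [cbnorm rho], so [lam] also bounds the pulled-back
   operator. *)
have [g cg|s ds ps] := cb_dual a0'_gt0 a1_gt0 prho2 lam0 _ e20.
  by rewrite rtr_link_pull //; apply: cbnorm_ge => //; exact: channel_comp.
have plam : psd (lam%:C%C *: s) by apply: psdZ => //; case: ds.
have [k uk kE] := psd_shift_factor plam e20.
rewrite -kE in ps.
have nk : nsq k = lam + e2 * a0'%:R.
  by rewrite /nsq kE rtrD !rtrZ rtr1 (density_rtr ds) mulr1.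
have Tz : rtr ((k *m adjmx k) *t 1%:M *m choi (hsadj (diff L))) = 0.
  rewrite /rtr tr_tens1 (@ptr2_choi_hsadj _ _ _ _ 0) => [|X].
    by rewrite conjc0 scale0r mulmx0 mxtrace0.
  by rewrite mul0r; exact: (tr_diff cPL cPhi2).
pose q1 := rtr (rho *m choi (hsadj ((Phi1 \o L) \o al))).
pose q2 := rtr (rho *m choi (hsadj (Phi2 \o al))).
have Tr2 : rtr (rho2 *m choi (hsadj (diff L))) = q1 - q2.
  rewrite (choi_hsadj_diff (Phi1 \o L) Phi2) mulmxBr rtrB.
  by rewrite (rtr_link_pull rho cal cPL) (rtr_link_pull rho cal cPhi2).
(* The test used is the complement of [rho2] in its bound, which reverses the sign: it is the
   advantage of [Phi2] over [Phi1 \o L] that must be controlled. *)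
have h2 : 2 * (0 - (q1 - q2)) <= nsq k * diamond (diff L).
  rewrite -Tz -Tr2 -rtrB -mulmxBl; apply: (rtr_choi_le_diamond a0'_gt0 cPL cPhi2 uk ps).
  by rewrite opprB addrCA subrr addr0.
have h1 : q1 <= comp_sup Phi1 rho := comp_sup_ge cPhi1 prho (channel_comp cL cal).
rewrite nk in h2; rewrite -/q2.
have dd0 : 0 <= diamond (diff L) := diamond_ge0 a0'_gt0 cPL cPhi2.
set dd := diamond (diff L) in hL h2 dd0; set S1 := comp_sup _ _ in h1 *.
have eE : e * (lam + 1) = x by rewrite /e divfK // gt_eqF // ltr_wpDl.
have e2E : e2 * (M + 1) = x by rewrite /e2 divfK // gt_eqF // ltr_wpDl.
have a0'R : 0 <= a0'%:R :> R by rewrite ler0n.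
have hdd : dd <= eps + e by apply: ltW; apply: (lt_le_trans hL); rewrite lerD2r.
have h3 : (lam + e2 * a0'%:R) * dd <= (lam + e2 * a0'%:R) * (eps + e).
  by apply: ler_wpM2l => //; rewrite addr_ge0 // mulr_ge0 // ltW.
have h4 : (lam + e2 * a0'%:R) * (eps + e) = lam * eps + e * (lam + 1) + e2 * (M + 1) - e - e2.
  by rewrite /M; ring.
rewrite eE e2E in h4.
clear -h1 h2 h3 h4 e0 e20; clearbody q1 q2 dd S1 lam e e2; lra.
Qed.

(** Here [b] may depend on the test and on the tolerance; [test_witness_delta_pre] finds one [b] for
    all tests. *)
Definition test_witness : Prop :=
  forall (W : 'M[C]_(a0' * a1)) s e, density s -> psd W -> psd (s *t 1%:M - W) -> 0 < e ->
  exists2 b : 'M[C]_a0' -> 'M[C]_a0, channel b &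
    rtr (W *m choi (hsadj Phi2)) <= rtr (W *m choi (hsadj (Phi1 \o b))) + eps / 2 + e.

Lemma choi_hsadj_comp_mix (b b' : 'M[C]_a0' -> 'M[C]_a0) (t : R) :
  choi (hsadj (Phi1 \o (fun X => (1 - t)%:C%C *: b X + t%:C%C *: b' X))) =
  (1 - t)%:C%C *: choi (hsadj (Phi1 \o b)) + t%:C%C *: choi (hsadj (Phi1 \o b')).
Proof.
have l := channel_lin cPhi1.
have E (phi : 'M[C]_a0' -> 'M[C]_a1) p i q j :
  choi (hsadj phi) (tix p i) (tix q j) = conjc (phi (delta_mx p q) i j).
  by rewrite choi_hsadj [LHS]mxE adjmxE JmxE.
have mixE k (x y : C) (X Y : 'M[C]_k) i j :
  (x *: X + y *: Y) i j = x * X i j + y * Y i j by rewrite !mxE.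
apply: tens_matrixP => p i q j; rewrite E /= (linmapD _ _ l) !(linmapZ _ _ l).
by rewrite !mixE conjcD !conjcM !conjc_real !E.
Qed.

Lemma test_witness_delta_pre : test_witness -> delta_pre Phi1 Phi2 <= eps.
Proof.
move=> tw; apply: le_addgt0 => x x0; pose e := x / 2.
have e0 : 0 < e by rewrite divr_gt0.
have [b0 cb0] := @channel_exists R a0' a0 a0_gt0.
(* Strategies enter as Choi matrices, on which mixing is linear; a test enters as the affine
   functional [<W, Phi1 \o b> + eps / 2 - <W, Phi2>]. *)
pose P : set 'M[C]_(a0' * a1) :=
  [set p | exists2 b : 'M[C]_a0' -> 'M[C]_a0, channel b & p = choi (hsadj (Phi1 \o b))].
pose S : set ('M[C]_(a0' * a1) * R) :=
  [set q | exists2 W, psd W /\ (exists2 s, density s & psd (s *t 1%:M - W)) &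
    q = (W, eps / 2 - rtr (W *m choi (hsadj Phi2)))].
have S0 : S (0, eps / 2 - rtr (0 *m choi (hsadj Phi2))).
  exists 0 => //; split; first exact: psd0.
  exists ((a0'%:R^-1)%:C%C *: 1%:M); first exact: density_scalar.
  by rewrite subr0; apply: psd_tens1; case: (@density_scalar R _ a0'_gt0).
have [|||||p [b cb ->] hb] := @minimax R _ P S (a0'%:R ^+ 2) (a1%:R ^+ 2 + (eps / 2 + 1))
  _ _ (ex_intro2 _ _ b0 cb0 erefl) S0 _ _ _ _ _ e e0.
- move=> _ _ [b cb ->] [b' cb' ->].
  exists (fun X => (1 - 2^-1)%:C%C *: b X + (2^-1)%:C%C *: b' X).
    by apply: channel_mix => //; apply/andP; split; lra.
  rewrite choi_hsadj_comp_mix scalerDr; congr (_%:C%C *: _ + _); lra.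
- move=> _ [b cb ->]; have cPb := channel_comp cPhi1 cb.
  apply: le_trans (psd_nsq (psd_choi_hsadj cPb)) _.
  suff -> : rtr (choi (hsadj (Phi1 \o b))) = a0'%:R by [].
  rewrite -[choi _]mul1mx -tens11 /rtr tr_tens1_choi; first exact: rtr1.
  by case: cPb.
- move=> t _ _ t01 [W [pW [s ds sW]] ->] [W' [pW' [s' ds' sW']] ->] /=.
  have /andP[t0 t1] := t01.
  exists ((1 - t)%:C%C *: W + t%:C%C *: W'); first split.
  + by apply: psdD; apply: psdZ; rewrite ?subr_ge0.
  + exists ((1 - t)%:C%C *: s + t%:C%C *: s'); first exact: density_mix.
    rewrite tens1D !tens1Z opprD addrACA -!scalerBr.
    have t1' : 0 <= 1 - t by rewrite subr_ge0.
    exact: (psdD (psdZ t1' sW) (psdZ t0 sW')).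
  by congr pair; rewrite mulmxDl -!scalemxAl rtrD !rtrZ; ring.
- move=> _ [W [pW [s ds sW]] ->] /=; split.
    apply: le_trans (psd_nsq pW) _; apply: (@le_trans _ _ (a1%:R ^+ 2)).
      rewrite lerXn2r ?nnegrE ?rtr_psd ?ler0n //.
      have := rtr_psd sW; rewrite rtrB rtr_tens1 (density_rtr ds) mulr1.
      by rewrite subr_ge0.
    by rewrite lerDl addr_ge0 // divr_ge0.
  have h1 := psd_rtr_ge0 pW (psd_choi_hsadj cPhi2).
  have := rtr_choi_channel_le cPhi2 sW; rewrite (density_rtr ds).
  by move=> h2; apply: norm_sub_le; rewrite ?divr_ge0 ?sqr_ge0.
- move=> _ y [W [pW [s ds sW]] ->] y0 /=.
  have [b cb hb] := tw W s y ds pW sW y0.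
  exists (choi (hsadj (Phi1 \o b))); first by exists b.
  exact: slack_le hb.
have cPb := channel_comp cPhi1 cb.
have d0 : 0 <= eps / 2 + e by rewrite addr_ge0 ?divr_ge0 // ltW.
have tb : test_bound (fun X => (Phi1 \o b) X - Phi2 X) (eps / 2 + e).
  move=> W s ds pW sW.
  (* The minimax inequality has the opposite sign, so it is applied to the complementary test, where
     a channel [g] takes the value [1 - <W, g>]. *)
  have sW' : psd (s *t 1%:M - (s *t 1%:M - W)) by rewrite opprB addrCA subrr addr0.
  rewrite (choi_hsadj_diff (Phi1 \o b) Phi2) mulmxBr rtrB.
  exact: (slack_sub_le (rtr_tens1B_choi s W cPb) (rtr_tens1B_choi s W cPhi2)
    (hb _ (ex_intro2 _ _ (s *t 1%:M - W) (conj sW (ex_intro2 _ _ s ds sW')) erefl))).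
have hdm := diamond_le a0'_gt0 cPb cPhi2 d0 tb.
apply: (@le_trans _ _ (diamond (diff b))).
  by apply: ge_inf; [case: has_inf_delta_pre|exists b].
by apply: le_trans hdm _; rewrite /e -mulrDl mulrC divfK ?pnatr_eq0.
Qed.

(** The conditions are homogeneous and can be used on a multiple of [W]. The identity is an
    admissible strategy on the left, and division by [q] returns to [W]; [B <= q] keeps the last
    term within [eps / 2]. *)
Lemma scaled_test_witness (W : 'M[C]_(a0' * a1)) (q B e : R) : psd W -> 0 < q -> B <= q ->
  comp_sup Phi2 (q%:C%C *: W) <= comp_sup Phi1 (q%:C%C *: W) + eps / 2 * B -> 0 < e ->
  exists2 b : 'M[C]_a0' -> 'M[C]_a0, channel b &
    rtr (W *m choi (hsadj Phi2)) <= rtr (W *m choi (hsadj (Phi1 \o b))) + eps / 2 + e.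
Proof.
move=> pW q0 Bq hh e0; have prho := psdZ (ltW q0) pW.
have h2 : q * rtr (W *m choi (hsadj Phi2)) <= comp_sup Phi2 (q%:C%C *: W).
  by have := comp_sup_ge cPhi2 prho (channel_id a0'); rewrite -scalemxAl rtrZ.
have [b cb hb] := comp_sup_adherent a0_gt0 cPhi1 prho (mulr_gt0 e0 q0).
exists b => //; rewrite -scalemxAl rtrZ in hb.
have hc : eps / 2 * B <= eps / 2 * q by rewrite ler_wpM2l // divr_ge0.
suff : q * rtr (W *m choi (hsadj Phi2)) <=
    q * (rtr (W *m choi (hsadj (Phi1 \o b))) + eps / 2 + e) by rewrite ler_pM2l.
rewrite 2!mulrDr [q * (eps / 2)]mulrC [q * e]mulrC.
exact: slack_sup_le h2 hh hc hb.
Qed.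

(** A test of trace zero vanishes and any channel beats it; all other tests can be normalised to
    states. *)
Lemma test_witness_pos :
  (forall (W : 'M[C]_(a0' * a1)) s e, density s -> psd W -> psd (s *t 1%:M - W) ->
    0 < rtr W -> 0 < e ->
    exists2 b : 'M[C]_a0' -> 'M[C]_a0, channel b &
      rtr (W *m choi (hsadj Phi2)) <= rtr (W *m choi (hsadj (Phi1 \o b))) + eps / 2 + e) ->
  test_witness.
Proof.
move=> h W s e ds pW sW e0.
have [t0|t0] := leP (rtr W) 0; last exact: (h W s e).
have W0 : W = 0.
  apply: nsq_eq0; apply: le_trans (psd_nsq pW) _.
  have -> : rtr W = 0 by apply/eqP; rewrite eq_le t0 rtr_psd.
  by rewrite expr2 mul0r.
have [b cb] := @channel_exists R a0' a0 a0_gt0; exists b => //.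
by rewrite W0 !mul0mx rtr0 add0r addr_ge0 ?divr_ge0 // ltW.
Qed.

Lemma cond_ii_test_witness : cond_ii Phi1 Phi2 eps a0' -> test_witness.
Proof.
move=> h; apply: test_witness_pos => W s e ds pW sW t0 e0.
(* Condition (ii) speaks of states, so [W] is divided by its trace; the norm of the result is at
   most the same factor, which therefore cancels. *)
have ti0 : 0 < (rtr W)^-1 by rewrite invr_gt0.
have prho := psdZ (ltW ti0) pW.
have drho : density (((rtr W)^-1)%:C%C *: W).
  by apply: rtr_density => //; rewrite rtrZ mulVf // gt_eqF.
have := h _ drho; rewrite !cbnorm_mtrans // => hh.
apply: (scaled_test_witness pW ti0 _ hh e0); apply: cbnorm_le => // g cg.
have /(rtr_choi_channel_le cg) :
    psd ((((rtr W)^-1)%:C%C *: s) *t 1%:M - ((rtr W)^-1)%:C%C *: W).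
  by rewrite tens1Z -scalerBr; exact: (psdZ (ltW ti0) sW).
by rewrite rtrZ (density_rtr ds) mulr1.
Qed.

End DeltaPre.

(** * State discrimination *)
Section Discrimination.
Context {R : realType}.
Local Notation C := (R[i]).
Local Open Scope classical_set_scope.
Implicit Types (m n r : nat).

Definition ens_op k r n (lam : 'I_k -> R) (rho : 'I_k -> 'M[C]_(r * n))
    (M : 'I_k -> 'M[C]_(n * n)) : 'M[C]_(r * n) :=
  \sum_i (lam i)%:C%C *: link (rho i) (swapmx (M i))^T.

Lemma psd_ens_op k r n (lam : 'I_k -> R) (rho : 'I_k -> 'M[C]_(r * n)) M :
  ensemble lam rho -> measurement M -> psd (ens_op lam rho M).
Proof.
move=> [l0 _ dr] [pM _]; apply: psd_sum => i _; apply: psdZ => //.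
by apply: psd_link; [case: (dr i)|apply/psd_tr/psd_swapmx].
Qed.

Lemma psucc_tensid k r n (lam : 'I_k -> R) (rho : 'I_k -> 'M[C]_(r * n))
    (M : 'I_k -> 'M[C]_(n * n)) (g : 'M[C]_r -> 'M[C]_n) : channel g ->
  psucc lam (fun i => tensid g (rho i)) M = rtr (ens_op lam rho M *m choi (hsadj g)).
Proof.
move=> cg; rewrite /ens_op mulmx_suml rtr_sum; apply: eq_bigr => i _.
rewrite -scalemxAl rtrZ; congr (_ * _).
by rewrite tr_tensid //; [exact: channel_lin|exact: channel_hp].
Qed.

Lemma sup_psucc k r m n (lam : 'I_k -> R) (rho : 'I_k -> 'M[C]_(r * n))
    (M : 'I_k -> 'M[C]_(n * n)) (Phi : 'M[C]_m -> 'M[C]_n) : channel Phi ->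
  sup [set psucc lam (fun i => tensid (Phi \o al) (rho i)) M
      | al in [set al : 'M[C]_r -> 'M[C]_m | channel al]] =
  comp_sup Phi (ens_op lam rho M).
Proof.
move=> cP; congr sup; apply: eq_imagel => a ca.
by rewrite psucc_tensid //; exact: channel_comp.
Qed.

(* For [T = choi (hsadj g)], [link T M] is the Heisenberg-picture image of [M]
   under [g]. *)
Lemma tr_link_swap m k n (X : 'M[C]_(m * k)) (M : 'M[C]_(n * k)) (T : 'M[C]_(m * n)) :
  \tr (link X (swapmx M)^T *m T) = \tr (X *m link T M).
Proof.
rewrite /mxtrace !big_tens; apply: eq_bigr => p _.
have E1 i : (link X (swapmx M)^T *m T) (tix p i) (tix p i) =
  \sum_q \sum_j \sum_a \sum_b
    X (tix p a) (tix q b) * M (tix j b) (tix i a) * T (tix q j) (tix p i).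
  rewrite mxE big_tens; apply: eq_bigr => q _; apply: eq_bigr => j _.
  rewrite linkE mulr_suml; apply: eq_bigr => a _; rewrite mulr_suml.
  by apply: eq_bigr => b _; rewrite [_^T _ _]mxE swapmxE.
have E2 a : (X *m link T M) (tix p a) (tix p a) =
  \sum_q \sum_b \sum_j \sum_i
    X (tix p a) (tix q b) * M (tix j b) (tix i a) * T (tix q j) (tix p i).
  rewrite mxE big_tens; apply: eq_bigr => q _; apply: eq_bigr => b _.
  rewrite linkE mulr_sumr; apply: eq_bigr => j _; rewrite mulr_sumr.
  by apply: eq_bigr => i _; rewrite mulrA mulrAC.
rewrite (eq_bigr _ (fun i _ => E1 i)) (eq_bigr _ (fun a _ => E2 a)).
rewrite exchange_big [RHS]exchange_big; apply: eq_bigr => q _.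
rewrite big_exchange22; apply: eq_bigr => a _; apply: eq_bigr => b _.
exact: exchange_big.
Qed.

Lemma link1r m n k (T : 'M[C]_(m * n)) : link T (1%:M : 'M[C]_(n * k)) = ptr2 T *t 1%:M.
Proof.
apply: tens_matrixP => q b p a; rewrite linkE tens_tixE [1%:M b a]mxE mxE mulr_suml.
apply: eq_bigr => j _; rewrite (bigD1 j) //= [X in _ + X]big1 ?addr0 => [|i /negPf ij].
  by rewrite -tens11 tens_tixE !mxE eqxx mul1r.
by rewrite -tens11 tens_tixE [1%:M j i]mxE eq_sym ij mulr0n mul0r mulr0.
Qed.

Lemma link_sumr m k n I (s : seq I) (P : pred I) (X : 'M[C]_(m * k)) (F : I -> 'M[C]_(k * n)) :
  link X (\sum_(i <- s | P i) F i) = \sum_(i <- s | P i) link X (F i).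
Proof.
apply: (big_morph (link X)) => [Y Z|]; apply: tens_matrixP => p i q j; rewrite !linkE.
  rewrite [RHS]mxE !linkE -big_split; apply: eq_bigr => a _; rewrite -big_split.
  by apply: eq_bigr => b _; rewrite mxE mulrDr.
by rewrite big1 ?mxE // => a _; rewrite big1 // => b _; rewrite mxE mulr0.
Qed.

Lemma psucc_le1 k n (lam : 'I_k -> R) (rho M : 'I_k -> 'M[C]_n) :
  ensemble lam rho -> measurement M -> psucc lam rho M <= 1.
Proof.
move=> [l0 l1 dr] [pM sM]; rewrite -l1; apply: ler_sum => i _.
rewrite -[leRHS]mulr1; apply: ler_wpM2l => //; rewrite -/(rtr _).
have [pr _] := dr i.
rewrite -(density_rtr (dr i)) -[X in _ <= rtr X]mulmx1 -sM mulmx_sumr rtr_sum.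
rewrite (bigD1 i) //= lerDl; apply: sumr_ge0 => j _; exact: psd_rtr_ge0.
Qed.

(** In the Heisenberg picture a channel turns [M] into a measurement on the ensemble itself, so each
    value under the supremum in [cbnorm] is a success probability. *)
Lemma cbnorm_ens_op_le k r n (lam : 'I_k -> R) (rho : 'I_k -> 'M[C]_(r * n))
    (M : 'I_k -> 'M[C]_(n * n)) : (0 < n)%N -> ensemble lam rho -> measurement M ->
  cbnorm (ens_op lam rho M) <= psucc_opt lam rho.
Proof.
move=> n0 El Mm; apply: cbnorm_le => // g cg.
pose M' i := link (choi (hsadj g)) (M i).
have mM' : measurement M'.
  have [pM sM] := Mm; split=> [i|]; first by apply: psd_link; [exact: psd_choi_hsadj|].
  rewrite /M' -link_sumr sM link1r (@ptr2_choi_hsadj _ _ _ _ 1) => [|X].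
    by rewrite conjc1 scale1r tens11.
  by rewrite mul1r; case: cg.
have -> : rtr (ens_op lam rho M *m choi (hsadj g)) = psucc lam rho M'.
  rewrite /ens_op mulmx_suml rtr_sum; apply: eq_bigr => i _.
  by rewrite -scalemxAl rtrZ /rtr tr_link_swap.
apply: (@sup_image_ge R _ [set M : 'I_k -> 'M[C]_(r * n) | measurement M]
  (fun M => psucc lam rho M) 1) => // N mN; exact: psucc_le1.
Qed.

Lemma link_rank1 m k n (X : 'M[C]_(m * k)) (y : 'cV[C]_(k * n)) :
  link X (y *m adjmx y) =
  (1%:M *t (\matrix_(i, a) y (tix a i) 0)) *m X
    *m adjmx (1%:M *t (\matrix_(i, a) y (tix a i) 0)).
Proof.
apply: tens_matrixP => p i q j; rewrite linkE mx1tens_conjE.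
apply: eq_bigr => a _; apply: eq_bigr => b _.
by rewrite [(y *m _) _ _]mxE big_ord1 adjmxE !mxE mulrCA mulrA.
Qed.

End Discrimination.

(** * Signed cyclic shifts and their measurement *)

Section SignedShifts.
Context {R : realType}.
Local Notation C := (R[i]).
Variable d' : nat.
Local Notation d := d'.+1.

Definition sshift_ix := ({ffun 'I_d -> bool} * 'I_d)%type.

(** A real substitute for the Weyl operators: signs replace the phases, so conjugation acts
    trivially on the entries, at the price of [2 ^ d] sign vectors. *)
Definition sshift (t : sshift_ix) : 'M[C]_d :=
  \matrix_(b, j) ((b == j + t.2)%:R * (-1) ^+ t.1 j).

Lemma conjc_sign (b : bool) : conjc ((-1) ^+ b : C) = (-1) ^+ b.
Proof. by case: b; rewrite ?expr0 ?expr1 ?conjcN conjc1. Qed.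

Lemma conjc_sshift t b j : conjc (sshift t b j) = sshift t b j.
Proof. by rewrite !mxE conjcM conjc_sign conjc_nat. Qed.

Lemma adj_sshift t : adjmx (sshift t) *m sshift t = 1%:M.
Proof.
apply/matrixP=> i j; rewrite mxE (bigD1 (i + t.2)) //= big1 ?addr0 => [|b /negPf bi].
  rewrite adjmxE conjc_sshift !mxE eqxx mul1r (inj_eq (addIr t.2)).
  have [->|_] := eqVneq i j; last by rewrite mul0r mulr0.
  by rewrite mul1r -expr2 sqrr_sign.
by rewrite adjmxE conjc_sshift mxE bi !mul0r.
Qed.

(** For distinct [i] and [j], flipping the sign at [i] is an involution of the index set that
    negates every term. *)
Lemma sum_sign (i j : 'I_d) :
  \sum_(f : {ffun 'I_d -> bool}) ((-1) ^+ f i * (-1) ^+ f j : C) =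
  (2 ^ d)%:R * (i == j)%:R.
Proof.
have [->|ij] := eqVneq i j.
  rewrite (eq_bigr (fun _ => 1)) => [|f _]; last by rewrite -expr2 sqrr_sign.
  by rewrite sumr_const card_ffun card_bool card_ord mulr1.
rewrite mulr0; set S := \sum_f _.
pose h (f : {ffun 'I_d -> bool}) : {ffun 'I_d -> bool} := [ffun k => f k (+) (k == i)].
have hK : involutive h.
  by move=> f; apply/ffunP => k; rewrite !ffunE -addbA addbb addbF.
have : S = - S.
  rewrite {1}/S (reindex_inj (inv_inj hK)) /S -sumrN; apply: eq_bigr => f _.
  rewrite !ffunE eqxx [j == i]eq_sym (negPf ij) addbT addbF.
  by case: (f i); rewrite ?expr0 ?expr1 /= ?mulN1r ?mul1r ?opprK.
by move=> /eqP; rewrite -addr_eq0 -mulr2n mulrn_eq0 => /eqP.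
Qed.

Definition sshift_vec (t : sshift_ix) : 'cV[C]_(d * d) :=
  \col_k sshift t (mxtens_unindex k).2 (mxtens_unindex k).1.

Lemma sshift_vecE t j b : sshift_vec t (tix j b) 0 = sshift t b j.
Proof. by rewrite mxE mxtens_indexK. Qed.

Definition sshift_povm (t : sshift_ix) : 'M[C]_(d * d) :=
  (((2 ^ d)%:R)^-1)%:C%C *: (sshift_vec t *m adjmx (sshift_vec t)).

(** Summing over signs kills the entries with distinct [j] and [i] and contributes [2 ^ d] to the
    others; of the shifts only the one by [b - j] then survives. *)
Lemma sum_sshift_povm : \sum_t sshift_povm t = 1%:M.
Proof.
apply: tens_matrixP => j b i a; rewrite summxE -tens11 tens_tixE.
have E t : sshift_povm t (tix j b) (tix i a) =
  (((2 ^ d)%:R)^-1)%:C%C * (((b == j + t.2) && (a == i + t.2))%:R *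
    ((-1) ^+ t.1 j * (-1) ^+ t.1 i)).
  rewrite mxE [(_ *m _) _ _]mxE big_ord1 adjmxE !sshift_vecE conjc_sshift !mxE.
  by rewrite mulrACA -natrM mulnb.
rewrite (eq_bigr _ (fun t _ => E t)) -mulr_sumr.
rewrite -(pair_bigA _ (fun f x => ((b == j + x) && (a == i + x))%:R *
    ((-1) ^+ (f : {ffun 'I_d -> bool}) j * (-1) ^+ f i) : C)) exchange_big /=.
under eq_bigr => x _ do rewrite -mulr_sumr sum_sign.
rewrite -mulr_suml !mxE.
have [<-|_] := eqVneq j i; last by rewrite !mulr0 mul0r.
rewrite mul1r mulr1 (bigD1 (b - j)) //= [X in _ + X]big1 ?addr0 => [|x /negPf xb].
  rewrite [j + _]addrC subrK eqxx /= [a == b]eq_sym mulrCA.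
  rewrite -(rmorph_nat (real_complex R) (2 ^ d)) -rmorphM mulVf ?rmorph1 ?mulr1 //.
  by rewrite pnatr_eq0 expn_eq0.
by rewrite [j + x]addrC -subr_eq [b - j == x]eq_sym xb.
Qed.

Lemma psd_sshift_povm t : psd (sshift_povm t).
Proof. by apply: psdZ; [rewrite invr_ge0 ler0n|exact: psd_mulmx_adj]. Qed.

Definition sshift_conj m (t : sshift_ix) (X : 'M[C]_(m * d)) : 'M[C]_(m * d) :=
  (1%:M *t sshift t) *m X *m adjmx (1%:M *t sshift t).

Lemma tens1_adj_sshift m t :
  adjmx (1%:M *t sshift t) *m (1%:M *t sshift t) = 1%:M :> 'M[C]_(m * d).
Proof. by rewrite adjmx_tens adjmx1 tensmx_mul mulmx1 adj_sshift tens11. Qed.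

Lemma rtr_sshift_conj m t (X : 'M[C]_(m * d)) : rtr (sshift_conj t X) = rtr X.
Proof. by rewrite /sshift_conj rtrC mulmxA tens1_adj_sshift mul1mx. Qed.

Lemma sshift_conj_tens1 m t (s : 'M[C]_m) : sshift_conj t (s *t 1%:M) = s *t 1%:M.
Proof.
rewrite /sshift_conj adjmx_tens adjmx1 !tensmx_mul mul1mx !mulmx1.
by rewrite (mulmx1C (adj_sshift t)).
Qed.

(** As in teleportation, outcome [t] undoes the shift [t], because the link with a vectorised shift
    is conjugation by its adjoint. Every member of the orbit thus contributes the same multiple of
    [X]. *)
Lemma link_sshift m t (X : 'M[C]_(m * d)) :
  link (sshift_conj t X) (swapmx (sshift_povm t))^T = (((2 ^ d)%:R)^-1)%:C%C *: X.
Proof.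
pose y : 'cV[C]_(d * d) := \col_k sshift t (mxtens_unindex k).1 (mxtens_unindex k).2.
have yE a i : y (tix a i) 0 = sshift t a i by rewrite mxE mxtens_indexK.
have -> : (swapmx (sshift_povm t))^T = (((2 ^ d)%:R)^-1)%:C%C *: (y *m adjmx y).
  apply: tens_matrixP => a i b j; rewrite [_^T _ _]mxE swapmxE /sshift_povm [LHS]mxE [RHS]mxE.
  congr (_ * _); rewrite ![(_ *m _) _ _]mxE !big_ord1 !adjmxE !sshift_vecE !yE.
  by rewrite !conjc_sshift mulrC.
have linkZ c (Y : 'M[C]_(d * d)) :
    link (sshift_conj t X) (c *: Y) = c *: link (sshift_conj t X) Y.
  apply: tens_matrixP => p i q j; rewrite [RHS]mxE !linkE mulr_sumr.
  apply: eq_bigr => a _; rewrite mulr_sumr; apply: eq_bigr => b _.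
  have -> : (c *: Y) (tix a i) (tix b j) = c * Y (tix a i) (tix b j) by rewrite mxE.
  by rewrite mulrCA.
rewrite linkZ link_rank1; congr (_ *: _).
have -> : \matrix_(i, a) y (tix a i) 0 = adjmx (sshift t).
  by apply/matrixP=> i a; rewrite mxE yE adjmxE conjc_sshift.
have -> : 1%:M *t adjmx (sshift t) = adjmx (1%:M *t sshift t) :> 'M[C]_(m * d).
  by rewrite adjmx_tens adjmx1.
rewrite adjmxK /sshift_conj !mulmxA tens1_adj_sshift mul1mx -mulmxA.
by rewrite tens1_adj_sshift mulmx1.
Qed.

End SignedShifts.

(** * Tests from the discrimination condition *)

Section CondIII.
Context {R : realType}.
Local Notation C := (R[i]).
Local Open Scope classical_set_scope.
Variables (a0 a0' d' : nat).
Local Notation d := d'.+1.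
Variables (Phi1 : 'M[C]_a0 -> 'M[C]_d) (Phi2 : 'M[C]_a0' -> 'M[C]_d) (eps : R).
Hypotheses (a0_gt0 : (0 < a0)%N) (a0'_gt0 : (0 < a0')%N).
Hypotheses (cPhi1 : channel Phi1) (cPhi2 : channel Phi2) (eps_ge0 : 0 <= eps).

(** The bound [s (x) 1] is invariant under the shifts, so it dominates the whole orbit of [W].
    Summed over any measurement it gives its trace [d], and the uniform prior over [2 ^ d * d]
    indices leaves [q / 2 ^ d]. *)
Lemma psucc_opt_sshift_le m (W : 'M[C]_(m * d)) s (q : R) : density s -> 0 <= q ->
  psd (s *t 1%:M - W) ->
  psucc_opt (fun _ : 'I_#|{: sshift_ix d'}| => #|{: sshift_ix d'}|%:R^-1)
    (fun i => sshift_conj (enum_val i) (q%:C%C *: W)) <= q / (2 ^ d)%:R.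
Proof.
move=> ds q0 sW; set N := #|_|.
have N0 : (0 < N)%N by apply/card_gt0P; exists ([ffun=> false], 0).
have NE : N = (2 ^ d * d)%N by rewrite /N card_prod card_ffun card_bool card_ord.
have Ni : 0 <= N%:R^-1 :> R by rewrite invr_ge0 ler0n.
pose M0 (_ : 'I_N) : 'M[C]_(m * d) := (N%:R^-1)%:C%C *: 1%:M.
have mM0 : measurement M0.
  split=> [i|]; first exact: (psdZ Ni (psd1 _)).
  rewrite /M0 sumr_const card_ord -scaler_nat scalerA -(rmorph_nat (real_complex R)).
  by rewrite -rmorphM mulfV ?rmorph1 ?scale1r // pnatr_eq0 -lt0n.
apply: (@sup_image_le R _ [set M : 'I_N -> 'M[C]_(m * d) | measurement M]
  (fun M => psucc _ _ M) _ M0) => // M [pM sM].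
have hi i : rtr (sshift_conj (enum_val i) (q%:C%C *: W) *m M i) <=
    q * rtr ((s *t 1%:M) *m M i).
  rewrite -rtrZ scalemxAl; apply: rtr_le; first exact: pM.
  have := psd_conj (1%:M *t sshift (enum_val i)) (psdZ q0 sW).
  rewrite scalerBr mulmxBr mulmxBl -!/(sshift_conj _ _).
  have -> : sshift_conj (enum_val i) (q%:C%C *: (s *t 1%:M)) = q%:C%C *: (s *t 1%:M).
    by rewrite -tens1Z sshift_conj_tens1.
  by [].
apply: (@le_trans _ _ (\sum_i N%:R^-1 * (q * rtr ((s *t 1%:M) *m M i)))).
  by apply: ler_sum => i _; apply: ler_wpM2l => //; exact: hi.
rewrite -mulr_sumr -mulr_sumr -rtr_sum -mulmx_sumr sM mulmx1 rtr_tens1 (density_rtr ds).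
rewrite mulr1 NE natrM invfM mulrC -mulrA ler_wpM2l //.
by rewrite mulrCA mulfV ?mulr1 // pnatr_eq0.
Qed.

Lemma cond_iii_test_witness : cond_iii Phi1 Phi2 eps a0' -> test_witness Phi1 Phi2 eps.
Proof.
move=> h; apply: test_witness_pos => // W s e ds pW sW t0 e0.
have ti0 : 0 < (rtr W)^-1 by rewrite invr_gt0.
pose rho := ((rtr W)^-1)%:C%C *: W.
have prho : psd rho := psdZ (ltW ti0) pW.
have rrho : rtr rho = 1 by rewrite rtrZ mulVf // gt_eqF.
pose N := #|{: sshift_ix d'}|.
have N0 : (0 < N)%N by apply/card_gt0P; exists ([ffun=> false], 0).
pose lam (_ : 'I_N) : R := N%:R^-1.
pose rhos (i : 'I_N) := sshift_conj (enum_val i) rho.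
pose M (i : 'I_N) : 'M[C]_(d * d) := sshift_povm (enum_val i).
have slam : \sum_i lam i = 1.
  by rewrite sumr_const card_ord -[LHS]mulr_natr mulVf // pnatr_eq0 -lt0n.
have Ens : ensemble lam rhos.
  split; [by move=> i; rewrite invr_ge0 ler0n|exact: slam|move=> i].
  by apply: rtr_density; [exact: psd_conj|rewrite rtr_sshift_conj].
have Mea : measurement M.
  split=> [i|]; first exact: psd_sshift_povm.
  by rewrite -[RHS](sum_sshift_povm d') [RHS]big_enum_val.
(* The factor that the measurement puts on the ensemble operator equals the bound on the success
   probability of the ensemble, so the two cancel. *)
pose q := (rtr W)^-1 / (2 ^ d)%:R.
have q0 : 0 < q by rewrite divr_gt0 // ltr0n expn_gt0.
have ensE : ens_op lam rhos M = q%:C%C *: W.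
  rewrite /ens_op; under eq_bigr => i _ do rewrite link_sshift.
  rewrite -scaler_suml -rmorph_sum slam rmorph1 scale1r /rho scalerA -rmorphM.
  by rewrite [_^-1 * _]mulrC.
have := h N lam rhos M Ens Mea.
rewrite !sup_psucc // ensE => hh.
apply: (scaled_test_witness a0_gt0 cPhi1 cPhi2 eps_ge0 pW q0 _ hh e0).
exact: (psucc_opt_sshift_le ds (ltW ti0) sW).
Qed.

End CondIII.

Theorem theorem6 (R : realType) (a0 a0' a1 : nat)
  (Phi1 : 'M[R[i]]_a0 -> 'M[R[i]]_a1) (Phi2 : 'M[R[i]]_a0' -> 'M[R[i]]_a1)
  (eps : R) :
  (0 < a0)%N -> (0 < a0')%N -> (0 < a1)%N ->
  channel Phi1 -> channel Phi2 -> 0 <= eps ->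
  [/\ delta_pre Phi1 Phi2 <= eps <-> (forall r : nat, cond_ii Phi1 Phi2 eps r),
      delta_pre Phi1 Phi2 <= eps <-> (forall r : nat, cond_iii Phi1 Phi2 eps r),
      delta_pre Phi1 Phi2 <= eps <-> cond_ii Phi1 Phi2 eps a0'
    & delta_pre Phi1 Phi2 <= eps <-> cond_iii Phi1 Phi2 eps a0'].
Proof.
move=> p0 p0' p1 c1 c2 e0.
have i_ii : delta_pre Phi1 Phi2 <= eps -> forall r, cond_ii Phi1 Phi2 eps r.
  move=> hd r rho [prho _]; rewrite !cbnorm_mtrans //.
  exact: delta_pre_comp_sup.
have i_iii : delta_pre Phi1 Phi2 <= eps -> forall r, cond_iii Phi1 Phi2 eps r.
  move=> hd r k lam rho M El Mm; rewrite !sup_psucc //.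
  have pE := psd_ens_op El Mm.
  apply: le_trans (delta_pre_comp_sup p0 p0' p1 c1 c2 e0 hd pE) _.
  by rewrite lerD2l ler_wpM2l ?divr_ge0 //; exact: cbnorm_ens_op_le.
have ii_i : cond_ii Phi1 Phi2 eps a0' -> delta_pre Phi1 Phi2 <= eps.
  by move=> h; apply: test_witness_delta_pre => //; exact: cond_ii_test_witness.
have iii_i : cond_iii Phi1 Phi2 eps a0' -> delta_pre Phi1 Phi2 <= eps.
  move=> h; apply: test_witness_delta_pre => //.
  (* Cyclic addition of indices requires [a1] to be written as a successor. *)
  case: a1 Phi1 Phi2 p1 c1 c2 h {i_ii i_iii ii_i} => // d' F1 F2 _ cF1 cF2 h.
  exact: cond_iii_test_witness.
split; split; auto.
Qed.
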